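(* Fix $\epsilon>0$. The problem $$\min_{x\in\mathcal X}\ \sup_{\mathbb Q\in\mathcal P_\epsilon}\mathbb E_{\mathbb Q}[\ell(x,\xi)]$$ is equivalent to the infinite linear program $$\begin{aligned}\min\ &\alpha+\beta\Omega+\int_{\mathcal X}\big(\mathbb E_{\hat{\mathbb P}_N}[\ell(z,\xi)]+\epsilon\big)\,\nu(\mathrm dz)\\ \text{s.t. }&x\in\mathcal X,\ \alpha\in\mathbb R,\ \beta\in\mathbb R_+,\ \nu\in\mathcal M_+(\mathcal X),\\ &\ell(x,\xi)\le\alpha+\beta\|\xi\|^2+\int_{\mathcal X}\ell(z,\xi)\,\nu(\mathrm dz)\qquad\forall\xi\in\Xi.\end{aligned}$$ Moreover, the infimum in this linear program is attained by some $(x,\alpha,\beta,\nu)\in\mathcal X\times\mathbb R\times\mathbb R_+\times\mathcal M_+(\mathcal X)$.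
   Context: The decision set $\mathcal X\subseteq\mathbb R^{D_x}$ is compact and convex, and $\Xi\subseteq\mathbb R^{D_\xi}$ is the support set of the random vector $\xi$; $\mathscr P(\Xi)$ is the set of probability distributions on $\Xi$. $\mathcal M_+(\mathcal X)$ is the cone of finite nonnegative Borel measures on $\mathcal X$. The loss is $\ell(x,\xi)=\max_{j\in[J]}\big(a_j(x)^\top\xi+b_j(x)\big)$ with $a_j(x)=\mathbf A_jx+\bar{\mathbf a}_j$ and $b_j(x)=\mathbf b_j^\top x+\bar b_j$ affine in $x$, and $c_1,c_2\ge 0$ satisfy $|\ell(x,\xi)|\le c_1+c_2\|\xi\|$ for all $x\in\mathcal X$, $\xi\in\Xi$. $\mathbb P^\star$ is the true distribution and $\hat{\mathbb P}_N\in\mathscr P(\Xi)$ is a data-driven reference distribution. The constant $\Omega$ satisfies $\mathbb E_{\hat{\mathbb P}_N}[\|\xi\|^2]<\Omega$ and $\mathbb E_{\mathbb P^\star}[\|\xi\|^2]\le\Omega$. $\mathbb Z$ is a probability distribution with full support on $\mathcal X$, $[u]_+=\max\{u,0\}$, and $$\mathcal P_\epsilon=\Big\{\mathbb Q\in\mathscr P(\Xi):\ \mathbb E_{z\sim\mathbb Z}\big[\big[\mathbb E_{\mathbb Q}[\ell(z,\xi)]-\mathbb E_{\hat{\mathbb P}_N}[\ell(z,\xi)]-\epsilon\big]_+\big]\le 0,\ \mathbb E_{\mathbb Q}[\|\xi\|^2]\le\Omega\Big\}.$$ ''Equivalent'' means that the two problems have the same optimal value and the same optimal decisions $x$. *)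

(* Defs.v *)
From HB Require Import structures.
From mathcomp Require Import all_boot all_order all_algebra.
From mathcomp Require Import all_classical all_reals all_analysis.

Set Implicit Arguments.
Unset Strict Implicit.
Unset Printing Implicit Defensive.

Import Order.TTheory GRing.Theory Num.Theory.
Import numFieldNormedType.Exports.

Local Open Scope classical_set_scope.
Local Open Scope ring_scope.

(* MathComp-Analysis puts no sigma-algebra on matrices; this is R^n with its
   Borel sigma-algebra, on a carrier convertible to 'cV[R]_n. *)
Notation borelcV R n := (g_sigma_algebraType (@open 'cV[R]_n)).

(* The library norm on 'cV[R]_n is the max norm; norms are taken as a parameter
   here, so that the Euclidean norm is covered. *)
Definition is_norm (R : realType) (n : nat) (N : 'cV[R]_n -> R) : Prop :=
  [/\ forall u v, N (u + v) <= N u + N v,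
      forall (a : R) u, N (a *: u) = `|a| * N u
    & forall u, N u = 0 -> u = 0].

(* Measures on a Borel set A of R^n are measures on R^n concentrated on A. *)
Definition prob_on (R : realType) (n : nat) (A : set 'cV[R]_n) :
    set (probability (borelcV R n) R) :=
  [set P | P A = 1%E].

Definition finite_measures_on (R : realType) (n : nat) (A : set 'cV[R]_n) :
    set {finite_measure set (borelcV R n) -> \bar R} :=
  [set nu | nu (~` A) = 0%E].

Definition full_support_on (R : realType) (n : nat) (A : set 'cV[R]_n)
    (P : probability (borelcV R n) R) : Prop :=
  prob_on A P /\
  forall x, A x -> forall U : set 'cV[R]_n, open U -> U x -> (0 < P U)%E.

Section Loss.
Variables (R : realType) (Dx Dxi J : nat).
Variables (A : 'I_J.+1 -> 'M[R]_(Dxi, Dx)) (abar : 'I_J.+1 -> 'cV[R]_Dxi).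
Variables (b : 'I_J.+1 -> 'cV[R]_Dx) (bbar : 'I_J.+1 -> R).

Definition slope (j : 'I_J.+1) (x : 'cV[R]_Dx) : 'cV[R]_Dxi :=
  A j *m x + abar j.

Definition intercept (j : 'I_J.+1) (x : 'cV[R]_Dx) : R :=
  ((b j)^T *m x) ord0 ord0 + bbar j.

Definition piece (j : 'I_J.+1) (x : 'cV[R]_Dx) (xi : 'cV[R]_Dxi) : R :=
  ((slope j x)^T *m xi) ord0 ord0 + intercept j x.

(* There are J.+1 >= 1 pieces; the first one seeds the maximum. *)
Definition loss (x : 'cV[R]_Dx) (xi : 'cV[R]_Dxi) : R :=
  \big[Num.max/piece ord0 x xi]_(j < J.+1) piece j x xi.

End Loss.

Section Optimization.
Variables (R : realType) (T : Type).

Definition optimal_value (F : set T) (f : T -> \bar R) : \bar R :=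
  ereal_inf [set f t | t in F].

Definition minimizers (F : set T) (f : T -> \bar R) : set T :=
  [set t | F t /\ f t = optimal_value F f].

End Optimization.

Section Problems.
Variables (R : realType) (Dx Dxi : nat).
Variables (X : set 'cV[R]_Dx) (Xi : set 'cV[R]_Dxi).
Variables (N : 'cV[R]_Dxi -> R) (l : 'cV[R]_Dx -> 'cV[R]_Dxi -> R).
Variables (Phat : probability (borelcV R Dxi) R).
Variables (Omega eps : R).

Local Open Scope ereal_scope.

Definition second_moment (Q : probability (borelcV R Dxi) R) : \bar R :=
  'E_Q[fun xi => (N xi ^+ 2)%R].

Definition ambiguity_set (Z : probability (borelcV R Dx) R) :
    set (probability (borelcV R Dxi) R) :=
  [set Q | [/\ prob_on Xi Q,
    \int[Z]_z maxe ('E_Q[l z] - 'E_Phat[l z] - eps%:E) 0 <= 0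
    & second_moment Q <= Omega%:E]].

Definition worst_case (Z : probability (borelcV R Dx) R) (x : 'cV[R]_Dx) :
    \bar R :=
  ereal_sup [set 'E_Q[l x] | Q in ambiguity_set Z].

Record lp_point := LPPoint {
  lp_x : 'cV[R]_Dx;
  lp_alpha : R;
  lp_beta : R;
  lp_nu : {finite_measure set (borelcV R Dx) -> \bar R} }.

Definition lp_feasible : set lp_point :=
  [set p | [/\ X (lp_x p), (0 <= lp_beta p)%R, finite_measures_on X (lp_nu p)
    & forall xi, Xi xi ->
        (l (lp_x p) xi)%:E <=
        (lp_alpha p + lp_beta p * N xi ^+ 2)%:E +
        \int[lp_nu p]_(z in X) (l z xi)%:E]].

Definition lp_objective (p : lp_point) : \bar R :=
  (lp_alpha p + lp_beta p * Omega)%:E +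
  \int[lp_nu p]_(z in X) ('E_Phat[l z] + eps%:E).

End Problems.

(* Main.v *)
From HB Require Import structures.
Require Import Defs.
From mathcomp Require Import all_boot all_order all_algebra.
From mathcomp Require Import all_classical all_reals all_analysis.
From mathcomp Require Import measurable_realfun ring lra.

Import Order.TTheory GRing.Theory Num.Theory.
Import numFieldNormedType.Exports.

Set Implicit Arguments.
Unset Strict Implicit.
Unset Printing Implicit Defensive.

Local Open Scope classical_set_scope.
Local Open Scope ring_scope.

(** Fix a decision x and let V be its worst-case expectation. The integral
constraint that defines the ambiguity set says that the positive part of
E_Q[l z] - E_Phat[l z] - eps vanishes Z-almost everywhere; since Z has full
support and z |-> E_Q[l z] is Lipschitz, it vanishes everywhere on X
([ambiguity_setP]). The inner supremum is thus a linear program over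
probability measures Q with one constraint for each z in X and one for the
second moment, and the infinite linear program is its Lagrange dual, with
multipliers nu and beta. Integrating a dual constraint against Q, with Fubini,
gives weak duality ([weak_duality]).

Strong duality with an attained dual rests on Phat being a Slater point: all
constraints hold at Phat with a slack bounded below by some sigma > 0. Mixing
Phat with a finitely supported measure shows that the constraints can be
replaced by an exact penalty: for the weight M = 2 eps / sigma, every finitely
supported nonnegative measure on Xi has a nonpositive integral against one of
the functions l x - V, l x - V - M (N^2 - Omega) or
l x - V - M (l z - E_Phat[l z] - eps) with z in X ([penalized_separation]).

It remains to exchange quantifiers: one probability on the index y of these
functions has to work for all points of Xi at once. For finitely many points
and up to an error, Blackwell's approachability argument produces such a
probability as the uniform average over a list of indices ([approachability]);
a limit along an ultrafilter of these averages is a positive linear functional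
that is nonpositive on all the functions ([minimax_functional]). Its part on X
is given by a finite measure by a Riesz representation theorem on compact sets
([riesz_representation]); that measure, scaled by M, is nu, and the weight of
the moment constraint gives beta ([dual_attained]).

Finally the worst-case value is Lipschitz in x, because second moments are
bounded by Omega on the ambiguity set, so it attains its minimum on the compact
set X ([worst_case_attained]), and the dual optimum for that x is optimal. *)

(** * Finite minimax and positive functionals *)

Lemma sqr_max0D_le (R : realType) (a b : R) :
  Num.max 0 (a + b) ^+ 2 <= Num.max 0 a ^+ 2 + 2 * (Num.max 0 a * b) + b ^+ 2.
Proof.
have -> : Num.max 0 a ^+ 2 + 2 * (Num.max 0 a * b) + b ^+ 2 =
  (Num.max 0 a + b) ^+ 2 by ring.
case: (leP 0 (a + b)) => [ab0|_]; last by rewrite expr0n sqr_ge0.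
by rewrite lerXn2r ?nnegrE //; case: (leP 0 a) => a0; lra.
Qed.

(** Blackwell's argument. Let S be the vector of the current sums. The next
point y is chosen for the weights S+, so the inner product of S+ with the
increment is nonpositive and the squared length of S+ grows by at most
|increment|^2 at each step. *)
Lemma approachability (R : realType) (I : eqType) (Y : Type) (D : set Y)
    (f : I -> Y -> R) (s : seq I) (B : I -> R) :
  (forall i y, D y -> `|f i y| <= B i) ->
  (forall w : I -> R, (forall i, 0 <= w i) ->
     exists2 y, D y & \sum_(i <- s) w i * f i y <= 0) ->
  forall n, exists2 ys : seq Y, size ys = n /\ (forall y, List.In y ys -> D y) &
    \sum_(i <- s) Num.max 0 (\sum_(y <- ys) f i y) ^+ 2 <=
      n%:R * \sum_(i <- s) B i ^+ 2.
Proof.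
move=> fB sep; elim=> [|n [ys [sz Dys] IH]].
  exists [::] => //; rewrite mul0r big1// => i _.
  by rewrite big_nil maxxx expr0n.
have [i|y Dy wy] := sep (fun i => Num.max 0 (\sum_(y <- ys) f i y)).
  by rewrite le_max lexx.
exists (y :: ys); first by split=> [|z /= [<-//|]]; [rewrite /= sz | exact: Dys].
rewrite -natr1 mulrDl mul1r.
apply: (@le_trans _ _ (\sum_(i <- s)
   (Num.max 0 (\sum_(y <- ys) f i y) ^+ 2
    + 2 * (Num.max 0 (\sum_(y <- ys) f i y) * f i y) + B i ^+ 2))).
  apply: ler_sum => i _; rewrite big_cons (addrC (f i y)).
  apply: (le_trans (sqr_max0D_le _ _)); rewrite lerD2l -real_normK ?num_real//.
  by rewrite lerXn2r ?nnegrE ?fB// (le_trans _ (fB i y Dy)).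
rewrite !big_split/= -mulr_sumr lerD2r.
by apply: le_trans IH; rewrite gerDl pmulr_rle0.
Qed.

(** After n steps the positive part of the sums is at most sqrt (n K), so the
averages are at most sqrt (K / n). *)
Lemma approx_minimax (R : realType) (I : eqType) (Y : Type) (D : set Y)
    (f : I -> Y -> R) (s : seq I) (B : I -> R) (d : R) :
  0 < d ->
  (forall i y, D y -> `|f i y| <= B i) ->
  (forall w : I -> R, (forall i, 0 <= w i) ->
     exists2 y, D y & \sum_(i <- s) w i * f i y <= 0) ->
  exists2 ys : seq Y, (0 < size ys)%N /\ (forall y, List.In y ys -> D y) &
    forall i, i \in s -> (\sum_(y <- ys) f i y) / (size ys)%:R <= d.
Proof.
move=> d0 fB sep; set K := \sum_(i <- s) B i ^+ 2.
have K0 : 0 <= K by apply: sumr_ge0 => i _; exact: sqr_ge0.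
(* The least number of steps with sqrt (K / n) < d. *)
pose n := (Num.truncn (K / d ^+ 2)).+1.
have nK : K < n%:R * d ^+ 2.
  rewrite -ltr_pdivrMr ?exprn_gt0//; exact: truncnS_gt.
have [ys [sz Dys] ysK] := approachability fB sep n.
exists ys; first by rewrite sz.
move=> i si; rewrite sz ler_pdivrMr ?ltr0n// leNgt; apply/negP => lt.
have n0 : 0 < n%:R :> R by rewrite ltr0n.
suff : (d * n%:R) ^+ 2 <= n%:R * K.
  have : 0 < n%:R * (n%:R * d ^+ 2 - K) by rewrite mulr_gt0// subr_gt0.
  by clear; lra.
apply: le_trans ysK; rewrite (big_rem i)//=.
rewrite -[leLHS]addr0 lerD//; last by apply: sumr_ge0 => j _; exact: sqr_ge0.
by rewrite lerXn2r ?nnegrE ?le_max ?lexx// ?(ltW lt) ?orbT// mulr_ge0// ltW.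
Qed.

Definition bounded_on (R : realType) (Y : Type) (D : set Y) (h : Y -> R) :=
  exists B : R, forall y, D y -> `|h y| <= B.

(** Linearity and positivity are only required on functions that are bounded
on D: this is what limits of averages along an ultrafilter satisfy. Such a
functional is a finitely additive measure on all subsets of D. *)
Record positive_functional (R : realType) (Y : Type) (D : set Y)
    (Lam : (Y -> R) -> R) : Prop := {
  pfD : forall h k, bounded_on D h -> bounded_on D k ->
    Lam (fun y => h y + k y) = Lam h + Lam k;
  pfZ : forall a h, bounded_on D h -> Lam (fun y => a * h y) = a * Lam h;
  pf_ge0 : forall h, bounded_on D h -> (forall y, D y -> 0 <= h y) ->
    0 <= Lam h }.

Definition average (R : realType) (Y : Type) (ys : seq Y) (h : Y -> R) : R :=
  (\sum_(y <- ys) h y) / (size ys)%:R.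

(** A cluster point exists by compactness of a segment, and an ultrafilter
converges to each of its cluster points. *)
Lemma ultra_bounded_cvg (R : realType) (P : Type) (G : set_system P)
    (u : P -> R) (B : R) :
  UltraFilter G -> (forall p, `|u p| <= B) -> cvg (u @ G).
Proof.
move=> GU uB.
have FG : ProperFilter G by exact: ultra_proper.
have Fu : ProperFilter (u @ G) by exact: fmap_proper_filter.
have [|p [_ clp]] := @segment_compact R (- B) B (u @ G) Fu.
  by apply: (@filterE _ G) => q /=; rewrite in_itv/= -ler_norml uB.
apply/cvg_ex; exists p => V Vp.
have [//|GnV] := in_ultra_setVsetC (u @^-1` V) GU.
have [q [nVq Vq]] : (~` V) `&` V !=set0 by apply: clp.
by case: nVq.
Qed.

(** For each finite set of indices and each error there is a good average;
an ultrafilter on these pairs that contains all the sets of finer pairs makes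
the averages converge on all bounded functions at the same time. *)
Lemma minimax_functional (R : realType) (I : eqType) (Y : Type) (D : set Y)
    (f : I -> Y -> R) :
  (forall i, bounded_on D (f i)) ->
  (forall (s : seq I) (w : I -> R), (forall i, 0 <= w i) ->
     exists2 y, D y & \sum_(i <- s) w i * f i y <= 0) ->
  exists Lam, [/\ positive_functional D Lam, Lam (fun=> 1) = 1
    & forall i, Lam (f i) <= 0].
Proof.
move=> /choice[B fB] sep.
have {}sep (p : seq I * nat) : exists ys : seq Y,
    [/\ (0 < size ys)%N, forall y, List.In y ys -> D y
      & forall i, i \in p.1 -> average ys (f i) <= p.2.+1%:R^-1].
  have d0 : 0 < p.2.+1%:R^-1 :> R by rewrite invr_gt0.
  have [ys [? ?] ?] := approx_minimax d0 fB (sep p.1).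
  by exists ys.
have {sep}[ys ysP] := choice sep.
(* Refinement: more indices and a smaller error. *)
pose base (q : seq I * nat) := [set p : seq I * nat |
  {subset q.1 <= p.1} /\ (q.2 <= p.2)%N].
have FF : ProperFilter (filter_from setT base).
  apply: filter_from_proper; last by move=> q _; exists q; split.
  apply: filter_from_filter; first by exists ([::], 0%N).
  move=> q r _ _; exists (q.1 ++ r.1, maxn q.2 r.2) => // p [/= sub].
  rewrite geq_max => /andP[qp rp]; split; split => // i ip; apply: sub.
    by rewrite mem_cat ip.
  by rewrite mem_cat ip orbT.
have [G [GU FG]] := ultraFilterLemma FF.
have GF : ProperFilter G by exact: ultra_proper.
pose Lam (h : Y -> R) := lim ((fun p => average (ys p) h) @ G).
have avg_bnd (h : Y -> R) (b : R) : (forall y, D y -> `|h y| <= b) ->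
    forall p, `|average (ys p) h| <= b.
  move=> hb p; have [sz Dy _] := ysP p.
  have s0 : 0 < (size (ys p))%:R :> R by rewrite ltr0n.
  rewrite /average normf_div (gtr0_norm s0) ler_pdivrMr//.
  apply: (le_trans (ler_norm_sum _ _ _)).
  elim: (ys p) Dy {sz s0} => [|y l IH] Dy; first by rewrite big_nil mulr0.
  rewrite big_cons /= -natr1 mulrDr mulr1 addrC lerD//.
    by apply: IH => z zl; apply: Dy; right.
  by apply: hb; apply: Dy; left.
have cv (h : Y -> R) : bounded_on D h -> (fun p => average (ys p) h) @ G --> Lam h.
  move=> [b hb]; apply: (@ultra_bounded_cvg _ _ _ _ b) => //.
  exact: avg_bnd.
exists Lam; split.
- split.
  + move=> h k bh bk; apply/cvg_lim => //.
    rewrite (_ : (fun p => _) = (fun p => average (ys p) h + average (ys p) k)).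
      by apply: cvgD; apply: cv.
    by apply/funext => p; rewrite /average big_split/= mulrDl.
  + move=> a h bh; apply/cvg_lim => //.
    rewrite (_ : (fun p => _) = (fun p => a * average (ys p) h)).
      by apply: cvgMl_tmp; apply: cv.
    by apply/funext => p; rewrite /average -mulr_sumr mulrA.
  + move=> h bh h0; apply: (limr_ge (cvgP _ (cv h bh))).
    apply: filterE => p /=; have [_ Dy _] := ysP p.
    rewrite mulr_ge0// ?invr_ge0//.
    elim: (ys p) Dy => [|y l IH] Dy; rewrite ?big_nil// big_cons.
    apply: addr_ge0; first by apply: h0; apply: Dy; left.
    by apply: IH => z zl; apply: Dy; right.
- apply/cvg_lim => //.
  rewrite (_ : (fun p => _) = (fun=> 1)); first exact: cvg_cst.
  apply/funext => p; have [sz _ _] := ysP p.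
  rewrite /average big_const_seq count_predT iter_addr addr0 divff//.
  by rewrite pnatr_eq0 -lt0n.
- move=> i; apply/ler_addgt0Pl => e e0; rewrite addr0.
  apply: (limr_le (cvgP _ (cv _ (ex_intro _ (B i) (fB i))))).
  apply: FG; exists ([:: i], Num.truncn e^-1) => // p [sub np] /=.
  have [_ _ /(_ i)] := ysP p; rewrite sub ?mem_head// => /(_ isT) h.
  apply: (le_trans h); rewrite invf_ple ?posrE//.
  by apply: ltW; apply: (lt_le_trans (truncnS_gt _)); rewrite ler_nat.
Qed.

(** * Compact subsets of a normed space *)

(** Heine's theorem on a compact subset, for a function that is continuous on
the whole space. *)
Lemma compact_unif_continuous (R : realType) (E : normedModType R)
    (X : set E) (h : E -> R) (e : R) :
  compact X -> continuous h -> 0 < e ->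
  exists2 d, 0 < d &
    forall x y, X x -> X y -> `|x - y| <= d -> `|h x - h y| <= e.
Proof.
move=> cX ch e0.
have nc : near_covering X by apply/compact_near_coveringP.
pose P (d : R) (x : E) := forall y, `|x - y| <= d -> `|h x - h y| <= e.
have cov x : X x -> \forall x' \near x & d \near (0 : R)^'+, P d x'.
  move=> _; have e20 : 0 < e / 2 by lra.
  have /cvgrPdist_lt/(_ _ e20)/nbhs_normP[r /= r0 hr] := ch x.
  exists (ball x (r / 2), [set d | d < r / 2]); first split.
  - by apply: nbhsx_ballx; lra.
  - by apply: nbhs_right_lt; lra.
  move=> [x' d] /= [xx' dr] y x'y.
  have h1 : `|h x - h x'| < e / 2.
    by apply: hr; move: xx'; rewrite -ball_normE /ball_/=; lra.
  have h2 : `|h x - h y| < e / 2.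
    apply: hr => /=; move: xx'; rewrite -ball_normE /ball_/= => xx'.
    have := ler_distD x' x y; lra.
  have := ler_distD (h x) (h x') (h y); rewrite (distrC (h x') (h x)); lra.
have /= [r /= r0 hr] := nc _ _ P _ cov.
exists (r / 2); first lra.
move=> x y Xx Xy xy; apply: (hr (r / 2)) => //=; last by lra.
by rewrite sub0r normrN gtr0_norm; lra.
Qed.

(** The first n sets of B cut X into cells of diameter at most e. *)
Definition separates_at (R : realType) (E : normedModType R) (X : set E)
    (B : nat -> set E) (n : nat) (e : R) :=
  forall x y, X x -> X y -> (forall i, (i < n)%N -> B i x <-> B i y) ->
    `|x - y| <= e.

(** The sets B are the balls of radius 1/(k+1) around the points of a finite
net of X, over all k. A point in a ball of the net k shares this ball with its
whole cell. *)
Lemma compact_separating (R : realType) (E : normedModType R) (X : set E) :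
  compact X ->
  exists B : nat -> set E, forall e : R, 0 < e -> exists n, separates_at X B n e.
Proof.
move=> cX.
have net k : exists s : seq E,
    forall x, X x -> exists2 c, c \in s & ball c (k.+1%:R^-1) x.
  have := cX; rewrite compact_cover => cX'.
  have [c _|x Xx|s _ sX] := cX' E setT (fun c => ball c (k.+1%:R^-1)).
  - exact: ball_open.
  - by exists x => //; exact: ballxx.
  exists (finmap.enum_fset s) => x /sX [c cs bx].
  by exists c.
have {net}[s sP] := choice net.
pose B n := if unpickle n is Some p then ball (nth 0 (s p.1) p.2) (p.1.+1%:R^-1)
            else set0 : set E.
exists B => e e0.
(* Two points of a ball of radius 1/(k+1) are at distance at most 2/(k+1). *)
pose k := Num.truncn (2 / e).
have ke : 2 * k.+1%:R^-1 < e.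
  rewrite ltr_pdivrMr ?ltr0n// mulrC -ltr_pdivrMr//.
  exact: truncnS_gt.
exists (\max_(j < size (s k)) pickle (k, nat_of_ord j)).+1 => x y Xx Xy xy.
have [c cs cx] := sP k x Xx.
have jlt : (index c (s k) < size (s k))%N by rewrite index_mem.
have Bx z : B (pickle (k, index c (s k))) z = ball c (k.+1%:R^-1) z.
  by rewrite /B pickleK /= nth_index.
have : ball c (k.+1%:R^-1) y.
  rewrite -Bx; apply/(xy _ _).1; last by rewrite Bx.
  rewrite ltnS; exact: (leq_bigmax (Ordinal jlt)).
move: cx; rewrite -!ball_normE /ball_/= => cx cy.
have := ler_distD c x y; rewrite (distrC x c).
by move: ke cx cy; set q := k.+1%:R^-1; lra.
Qed.

(** * Riesz representation on a compact set *)

Lemma bounded_onD (R : realType) (Y : Type) (D : set Y) (h k : Y -> R) :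
  bounded_on D h -> bounded_on D k -> bounded_on D (fun y => h y + k y).
Proof.
move=> [a ha] [b kb]; exists (a + b) => y Dy.
by rewrite (le_trans (ler_normD _ _))// lerD ?ha ?kb.
Qed.

Lemma bounded_onZ (R : realType) (Y : Type) (D : set Y) (a : R) (h : Y -> R) :
  bounded_on D h -> bounded_on D (fun y => a * h y).
Proof.
by move=> [b hb]; exists (`|a| * b) => y Dy; rewrite normrM ler_wpM2l ?hb.
Qed.

Lemma bounded_on_cst (R : realType) (Y : Type) (D : set Y) (c : R) :
  bounded_on D (fun=> c).
Proof. by exists `|c|. Qed.

Lemma bounded_onM_indic (R : realType) (Y : Type) (D C : set Y) (h : Y -> R) :
  bounded_on D h -> bounded_on D (fun y => h y * \1_C y).
Proof.
move=> [b hb]; exists b => y Dy; rewrite indicE; case: (_ \in _).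
  by rewrite mulr1 hb.
by rewrite mulr0 normr0 (le_trans _ (hb y Dy)).
Qed.

Lemma pf_le (R : realType) (Y : Type) (D : set Y) Lam (h k : Y -> R) :
  positive_functional D Lam -> bounded_on D h -> bounded_on D k ->
  (forall y, D y -> h y <= k y) -> Lam h <= Lam k.
Proof.
move=> PL bh bk hk; rewrite -subr_ge0.
have bNh := bounded_onZ (-1) bh.
have := pf_ge0 PL (bounded_onD bk bNh).
rewrite (pfD PL)// (pfZ PL)// mulN1r; apply => y Dy.
by rewrite mulN1r subr_ge0 hk.
Qed.

Lemma pf_eq (R : realType) (Y : Type) (D : set Y) Lam (h k : Y -> R) :
  positive_functional D Lam -> bounded_on D h -> bounded_on D k ->
  (forall y, D y -> h y = k y) -> Lam h = Lam k.
Proof.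
move=> PL bh bk hk; apply/le_anti/andP; split; apply: (pf_le PL) => // y Dy;
  by rewrite hk.
Qed.

Lemma itvco_lty (R : realType) (a b : R) :
  (lebesgue_measure (`[a, b[%classic : set R) < +oo)%E.
Proof.
by rewrite lebesgue_measure_itv/=; case: ifP; rewrite ?ltry -?EFinB ?ltry.
Qed.

Lemma itvco_length (R : realType) (a p : R) : 0 <= p ->
  fine (lebesgue_measure (`[a, a + p[%classic : set R)) = p.
Proof.
rewrite lebesgue_measure_itv/= lte_fin ltrDl le_eqVlt => /predU1P[<-|p0].
  by rewrite ltxx.
by rewrite p0 -EFinB/= addrC addKr.
Qed.

(** The functional Lam gives a mass to each subset of X, but this mass is only
finitely additive. The cells cut out by the first n sets of B are laid out as
consecutive intervals whose lengths are their masses, each level refining the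
previous one. A real t in [0, mass setT[ then selects a decreasing sequence of
nonempty cells that shrinks to one point, param t, and the image of Lebesgue
measure under param represents Lam on continuous functions. *)
Section representation.
Context {R : realType} {E : normedModType R} {X : set E} {Lam : (E -> R) -> R}.
Variable (B : nat -> set E) (x0 : E).
Hypothesis PL : positive_functional X Lam.

(** The factor 1 makes this an instance of the products by an indicator that
[pf_split] cuts. *)
Definition mass (C : set E) := Lam (fun y => 1 * \1_C y).

Let b1 C : bounded_on X (fun y : E => 1 * \1_C y : R).
Proof. exact/bounded_onM_indic/bounded_on_cst. Qed.

Lemma mass_ge0 C : 0 <= mass C.
Proof. by apply: (pf_ge0 PL) => // y _; rewrite mul1r indicE ler0n. Qed.

Lemma pf_split (C D : set E) h : bounded_on X h ->
  Lam (fun y => h y * \1_C y) =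
  Lam (fun y => h y * \1_(C `&` D) y) + Lam (fun y => h y * \1_(C `\` D) y).
Proof.
move=> bh; rewrite -(pfD PL); try exact: bounded_onM_indic.
congr Lam; apply/funext => y; rewrite !indicE in_setI in_setD.
by case: (y \in C); case: (y \in D); rewrite ?mulr0 ?mulr1 ?addr0 ?add0r.
Qed.

Lemma mass_split C D : mass C = mass (C `&` D) + mass (C `\` D).
Proof. exact/pf_split/bounded_on_cst. Qed.

Lemma mass_empty C : X `&` C = set0 -> mass C = 0.
Proof.
move=> XC; rewrite -[RHS](mul0r (mass C)) /mass -(pfZ PL)//.
apply: (pf_eq PL) => //; first exact: bounded_onZ.
move=> y Xy; rewrite mul0r indicE; case: (boolP (y \in C)); rewrite ?mulr0//.
by rewrite inE => Cy; have : (X `&` C) y by []; rewrite XC.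
Qed.

(** The cell of level n selected by t, with the left end of its interval. *)
Fixpoint cell (t : R) (n : nat) : set E * R :=
  if n is n'.+1 then
    let: (C, a) := cell t n' in
    if t < a + mass (C `&` B n') then (C `&` B n', a)
    else (C `\` B n', a + mass (C `&` B n'))
  else (setT, 0).

(** The tree of all cells, with the left ends of their intervals: properties of
a cell are obtained from those of its two children by induction on the number
of remaining levels, without enumerating a level. *)
Inductive node : nat -> set E -> R -> Prop :=
| node_root : node 0 setT 0
| node_in n C a : node n C a -> node n.+1 (C `&` B n) a
| node_out n C a : node n C a ->
    node n.+1 (C `\` B n) (a + mass (C `&` B n)).

Lemma cell_node n C a t : node n C a -> a <= t < a + mass C ->
  cell t n = (C, a).
Proof.
move=> nd; elim: nd t => {n C a}[//|n C a _ IH|n C a _ IH] t /andP[at_ ta] /=.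
  rewrite IH ?ta// at_/= (lt_le_trans ta)// lerD2l (mass_split C (B n)).
  by rewrite lerDl mass_ge0.
rewrite IH; first by rewrite ltNge at_.
rewrite (le_trans _ at_) ?lerDl ?mass_ge0//=.
by rewrite (mass_split C (B n)) addrA.
Qed.

Lemma cellP t n : 0 <= t < mass setT ->
  node n (cell t n).1 (cell t n).2 /\
  (cell t n).2 <= t < (cell t n).2 + mass (cell t n).1.
Proof.
move=> t0m; elim: n => [|n] /=; first by rewrite add0r; split; [exact: node_root|].
case: (cell t n) => C a /= [nd /andP[at_ ta]].
case: ltP => h /=; split.
- exact: node_in.
- by rewrite at_.
- exact: node_out.
- by rewrite h -addrA -mass_split.
Qed.

Lemma cell_decr t n m : (n <= m)%N -> (cell t m).1 `<=` (cell t n).1.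
Proof.
elim: m => [|m IH]; first by rewrite leqn0 => /eqP ->.
rewrite leq_eqVlt => /predU1P[->//|/IH {}IH] x /=; move: IH.
by case: (cell t m) => C a /= IH; case: ifP => _ /= [Cx _]; apply: IH.
Qed.

Lemma node_agree n C a : node n C a -> forall x y, C x -> C y ->
  forall i, (i < n)%N -> B i x <-> B i y.
Proof.
elim=> {n C a}[//|n C a _ IH|n C a _ IH] x y [Cx Bx] [Cy By] i;
  rewrite ltnS leq_eqVlt => /predU1P[->//|]; exact: IH.
Qed.

Lemma cell_nonempty t n : 0 <= t < mass setT -> X `&` (cell t n).1 !=set0.
Proof.
move=> /(cellP n)[_ /andP[at_ ta]]; apply/set0P/eqP => /mass_empty m0.
by move: ta; rewrite m0 addr0 ltNge at_.
Qed.

Definition rep (C : set E) := xget x0 (X `&` C).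

Lemma repP t n : 0 <= t < mass setT -> (X `&` (cell t n).1) (rep (cell t n).1).
Proof. by move=> /(cell_nonempty n)[x xP]; apply: xgetPex; exists x. Qed.

Definition limit_point t y := X y /\ forall n e, separates_at X B n e ->
  forall x, (X `&` (cell t n).1) x -> `|x - y| <= e.

Hypothesis cX : compact X.

(** By compactness of X the points [rep (cell t n)] have a cluster point; it
need not lie in the cells, but it lies in their closures. *)
Lemma limit_point_exists t : 0 <= t < mass setT -> exists y, limit_point t y.
Proof.
move=> t0m; pose F := (fun k => rep (cell t k).1) @ \oo.
have [|y [Xy cly]] := cX (_ : ProperFilter F).
  by exists 0%N => // k _; have [] := repP k t0m.
exists y; split => // n e sep x [Xx Cx].
apply/ler_addgt0Pr => d d0.
have [z [[Xz Cz] yz]] : (X `&` (cell t n).1) `&` ball y d !=set0.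
  apply: cly; last exact: nbhsx_ballx.
  exists n => // k /= nk; have [Xr Cr] := repP k t0m.
  by split=> //; exact: cell_decr Cr.
move: yz; rewrite -ball_normE /ball_/= => yz.
have xz : `|x - z| <= e.
  by apply: sep => //; apply: node_agree (proj1 (cellP n t0m)) _ _ Cx Cz.
by have := ler_distD z x y; rewrite (distrC z y); lra.
Qed.

Definition param t := if 0 <= t < mass setT then xget x0 (limit_point t) else x0.

Lemma paramP t : 0 <= t < mass setT -> limit_point t (param t).
Proof.
by move=> t0m; rewrite /param t0m; apply: xgetPex; exact: limit_point_exists.
Qed.

Lemma param_in t : X x0 -> X (param t).
Proof.
move=> Xx0; have [/paramP[]//|t0m] := boolP (0 <= t < mass setT).
by rewrite /param (negbTE t0m).
Qed.

(** At level n + j a predicate of the selected cell is constant on finitely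
many intervals. *)
Lemma measurable_cell_pred (P : set E -> Prop) j n C a : node n C a ->
  measurable [set t | a <= t < a + mass C /\ P (cell t (n + j)).1].
Proof.
elim: j n C a => [|j IH] n C a nd.
  rewrite addn0; have [PC|PC] := pselect (P C).
    rewrite (_ : mkset _ = `[a, (a + mass C)[%classic)//.
    apply/seteqP; split => t /=; rewrite in_itv/=; first by case.
    by move=> h; split => //; rewrite (cell_node nd h).
  rewrite (_ : mkset _ = set0)//; apply/seteqP; split => t //= [h].
  by rewrite (cell_node nd h).
rewrite addnS -addSn.
rewrite (_ : mkset _ =
  [set t | a <= t < a + mass (C `&` B n) /\ P (cell t (n.+1 + j)).1] `|`
  [set t | a + mass (C `&` B n) <= t <
      a + mass (C `&` B n) + mass (C `\` B n) /\ P (cell t (n.+1 + j)).1]).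
  by apply: measurableU; apply: IH; [exact: node_in|exact: node_out].
have m0 := mass_ge0 (C `&` B n); have m1 := mass_ge0 (C `\` B n).
rewrite (mass_split C (B n)) -addrA.
apply/seteqP; split => t /=.
  move=> [/andP[h1 h2] p]; case: (ltP t (a + mass (C `&` B n))) => h.
    by left; split => //; apply/andP.
  by right; split => //; apply/andP.
by move=> [] [/andP[h1 h2] p]; split => //; apply/andP; split => //; lra.
Qed.

Hypothesis sepB : forall e : R, 0 < e -> exists n, separates_at X B n e.

(** [param t] lies in an open U iff, at some level, the ball around the
representative that has twice the accuracy of this level as radius lies in U.
This is a countable union of conditions on the selected cell. *)
Lemma measurable_param (U : set E) : open U ->
  measurable (`[0, mass setT[%classic `&` param @^-1` U : set R).
Proof.
move=> oU.
pose P n C := exists e : R,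
  [/\ 0 < e, separates_at X B n e & ball (rep C) (2 * e) `<=` U].
rewrite (_ : _ `&` _ = \bigcup_n [set t | 0 <= t < 0 + mass setT /\
  P n (cell t (0 + n)).1]).
  by apply: bigcup_measurable => n _; apply: measurable_cell_pred; exact: node_root.
rewrite add0r; apply/seteqP; split => t.
  move=> [/=]; rewrite in_itv/= => t0m Ut.
  have /nbhs_ballP[d /= d0 dU] : nbhs (param t) U by exact: open_nbhs_nbhs.
  have d30 : 0 < d / 3 by lra.
  have [n sep] := sepB d30; exists n => //=; split => //.
  exists (d / 3); split=> // z; have [_ /(_ n _ sep _ (repP n t0m))] := paramP t0m.
  rewrite -ball_normE /ball_/= => h1 h2; apply: dU; rewrite -ball_normE /ball_/=.
  have := ler_distD (rep (cell t n).1) (param t) z.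
  by rewrite (distrC (param t) (rep _)); lra.
move=> [n _ /=]; rewrite add0n in_itv/= => -[t0m [e [e0 sep eU]]]; split => //.
apply: eU; have [_ /(_ n e sep _ (repP n t0m)) h] := paramP t0m.
rewrite -ball_normE /ball_/=.
by apply: (le_lt_trans h); rewrite mulrDl mul1r ltrDl.
Qed.

Local Notation mu := (@lebesgue_measure R).

Lemma measurable_param_on :
  measurable_fun `[0, mass setT[%classic
    (param : measurableTypeR R -> g_sigma_algebraType (@open E)).
Proof.
apply: (@measurability _ _ (measurableTypeR R) (g_sigma_algebraType (@open E))
  _ _ (@open E)) => // _ [U oU <-].
exact: measurable_param.
Qed.

Lemma node_range n C a : node n C a -> 0 <= a /\ a + mass C <= mass setT.
Proof.
elim=> {n C a}[|n C a _ [a0 am]|n C a _ [a0 am]]; first by rewrite add0r.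
  split=> //; apply: le_trans am; rewrite lerD2l (mass_split C (B n)).
  by rewrite lerDl mass_ge0.
by rewrite addr_ge0 ?mass_ge0//; split => //; rewrite -addrA -mass_split.
Qed.

Hypothesis Xx0 : X x0.
Variable h : E -> R.
Hypothesis bh : bounded_on X h.
Hypothesis mh : measurable_fun `[0, mass setT[%classic (h \o param).

Lemma integrable_param (a b c : R) : 0 <= a -> b <= mass setT ->
  mu.-integrable `[a, b[ (EFin \o (fun t => h (param t) + c)).
Proof.
move=> a0 bm; apply: measurable_bounded_integrable => //.
- exact: itvco_lty.
- apply: (@measurable_funS _ _ _ _ `[0, mass setT[%classic) => //.
    move=> t /=; rewrite !in_itv/= => /andP[at_ tb].
    by rewrite (le_trans a0 at_) (lt_le_trans tb bm).
  exact: measurable_funD.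
- case: bh => M hM; exists (M + `|c|); split; first exact: num_real.
  move=> x Mx t _; apply: le_trans (ltW Mx).
  by rewrite (le_trans (ler_normD _ _))// lerD2r hM//; exact: param_in.
Qed.

Variables (d e : R) (N : nat).
Hypothesis sepN : separates_at X B N d.
Hypothesis hde : forall x y, X x -> X y -> `|x - y| <= d -> `|h x - h y| <= e.

(** Both sides are additive when a cell is split, so it is enough to compare
them on the cells of a level N where h oscillates by at most e: there h is
within e of its value at the representative, on the cell as well as at
[param t]. *)
Lemma pf_le_integral n j C a : node n C a -> (n + j = N)%N ->
  Lam (fun y => h y * \1_C y) <=
    \int[mu]_(t in `[a, a + mass C[) (h (param t) + 2 * e).
Proof.
elim: j n C a => [|j IH] n C a nd.
  rewrite addn0 => nN; rewrite {}nN in nd *; set c := h (rep C).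
  have [a0 am] := node_range nd.
  apply: (@le_trans _ _ ((c + e) * mass C)).
    rewrite -(pfZ PL)//; apply: (pf_le PL).
    - exact: bounded_onM_indic.
    - exact: bounded_onZ.
    move=> y Xy; rewrite mul1r indicE; case: (boolP (y \in C)) => [|_]; last first.
      by rewrite !mulr0.
    rewrite inE !mulr1 => Cy.
    have [Xr Cr] : (X `&` C) (rep C) by apply: xgetPex; exists y.
    have := hde Xy Xr (sepN Xy Xr (node_agree nd Cy Cr)).
    by rewrite ler_norml /c => /andP[_]; lra.
  have -> : (c + e) * mass C = \int[mu]_(t in `[a, a + mass C[) (c + e).
    rewrite Rintegral_cst//; congr (_ * _); apply/esym; apply: itvco_length.
    exact: mass_ge0.
  apply: le_Rintegral => //.
  - apply: measurable_bounded_integrable => //.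
      exact: itvco_lty.
    by exists `|c + e|; split; [exact: num_real|move=> x /ltW lx t _].
  - exact: integrable_param.
  move=> t /=; rewrite in_itv/= => tC.
  have t0m : 0 <= t < mass setT.
    by move: tC => /andP[at_ ta]; rewrite (le_trans a0 at_) (lt_le_trans ta am).
  have := paramP t0m; have := repP N t0m.
  rewrite (cell_node nd tC)/= => -[Xr Cr] [Xp /(_ N d sepN _)].
  rewrite (cell_node nd tC)/= => /(_ _ (conj Xr Cr)) /(hde Xr Xp).
  by rewrite ler_norml -/c => /andP[]; lra.
move=> nj; have [a0 am] := node_range nd.
rewrite (pf_split C (B n) bh).
apply: (le_trans (lerD (IH _ _ _ (node_in nd) _) (IH _ _ _ (node_out nd) _)));
  rewrite ?addSnnS//.
rewrite -Rintegral_setU//.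
- by rewrite -itv_bndbnd_setU ?bnd_simp ?lerDl ?mass_ge0// -addrA -mass_split.
- rewrite -itv_bndbnd_setU ?bnd_simp ?lerDl ?mass_ge0//.
  by apply: integrable_param => //; rewrite -addrA -mass_split.
- apply/disj_setPS => t [] /=; rewrite !in_itv/= => /andP[_ ta] /andP[].
  by rewrite leNgt ta.
Qed.
End representation.

Lemma continuous_borel_measurable (R : realType) (E : normedModType R)
    (h : E -> R) :
  continuous h -> measurable_fun setT (h : g_sigma_algebraType (@open E) -> R).
Proof.
move=> /continuousP ch; apply: (measurability _ (RGenOpens.measurableE R)).
move=> _ [_ [a [b ->] <-]]; rewrite setTI; apply: sub_sigma_algebra.
exact/ch/interval_open.
Qed.

Lemma compact_borel_measurable (R : realType) (E : normedModType R)
    (X : set E) :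
  compact X -> measurable (X : set (g_sigma_algebraType (@open E))).
Proof.
move=> /(compact_closed (@norm_hausdorff _ _)) /closed_openC oX.
by rewrite -[X]setCK; apply: measurableC; exact: sub_sigma_algebra.
Qed.

Lemma continuous_bounded_on (R : realType) (E : normedModType R) (X : set E)
    (h : E -> R) : compact X -> continuous h -> bounded_on X h.
Proof.
move=> cX ch.
have /compact_bounded[M [_ hM]] : compact (h @` X).
  by apply: continuous_compact => //; exact: continuous_subspaceT.
exists (M + 1) => x Xx; apply: hM; first by rewrite ltrDl.
by exists x.
Qed.

(** The measure is the image under [param] of Lebesgue measure on the interval
[0, Lam 1[. The inequality of [pf_le_integral], at the root and with an
arbitrarily small error, becomes an equality when applied to h and to - h. *)
Lemma riesz_representation (R : realType) (E : normedModType R) (X : set E)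
    (x0 : E) (Lam : (E -> R) -> R) :
  compact X -> X x0 -> positive_functional X Lam ->
  exists nu : {finite_measure set (g_sigma_algebraType (@open E)) -> \bar R},
    nu (~` X) = 0%E /\
    forall h : E -> R, continuous h ->
      (\int[nu]_(x in X) (h x)%:E = (Lam h)%:E)%E.
Proof.
move=> cX Xx0 PL; have [B sepB] := compact_separating cX.
pose T := @param R E X Lam B x0 :
  measurableTypeR R -> g_sigma_algebraType (@open E).
pose m := @mass R E Lam setT.
have m0 : 0 <= m by exact: (mass_ge0 PL).
have mI : measurable (`[0, m[%classic : set R) by [].
have mTI : measurable_fun `[0, m[%classic T by exact: measurable_param_on.
have mT : measurable_fun setT T.
  rewrite -(setvU `[0, m[%classic); apply/measurable_funU => //.
    exact: measurableC.
  split=> //.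
  apply: (eq_measurable_fun (cst (x0 : g_sigma_algebraType (@open E)))).
    move=> t; rewrite inE /= in_itv/= => /negP/negbTE t0m.
    by rewrite /T /param /cst -/m t0m.
  exact: measurable_cst.
have XT t : X (T t) by exact: param_in.
pose mu : {measure set (measurableTypeR R) -> \bar R} :=
  mrestr (@lebesgue_measure R) mI.
pose nu0 := measure_function_pushforward__canonical__measure_function_Measure
  mu mT.
have muT : (mu setT < +oo)%E by rewrite /mu /= /mrestr setTI; exact: itvco_lty.
have fin : fin_num_fun (pushforward mu T).
  by apply: (@lty_fin_num_fun _ _ _ nu0).
pose nu : {finite_measure set (g_sigma_algebraType (@open E)) -> \bar R} :=
 HB.pack (pushforward mu T) (@Measure_isFinite.Build _ _ _ nu0 fin).
exists (nu mT); split.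
  rewrite /nu/= /pushforward (_ : _ @^-1` _ = set0) ?measure0//.
  by apply/seteqP; split => t //=; apply; exact: XT.
move=> h ch.
have bh := continuous_bounded_on cX ch.
have mh := continuous_borel_measurable ch.
have mhT : measurable_fun setT (h \o T) by exact: measurableT_comp mh mT.
have iT : mu.-integrable setT (EFin \o (h \o T)).
  apply: measurable_bounded_integrable => //.
  case: bh => M hM; exists M; split; first exact: num_real.
  by move=> x /ltW Mx t _; apply: le_trans Mx; exact/hM/XT.
have TX : T @^-1` X = setT by apply/seteqP; split => // t _; exact: XT.
have -> : (\int[nu mT]_(x in X) (h x)%:E =
  \int[@lebesgue_measure R]_(t in `[0%R, m[) (h (T t))%:E)%E.
  transitivity (\int[mu]_(t in T @^-1` X) ((EFin \o h) (T t)))%E.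
    apply: (@integral_pushforward _ _ _ _ _ _ mT mu X (EFin \o h)).
    - exact/measurable_EFinP.
    - by rewrite TX.
    - exact: compact_borel_measurable.
  rewrite TX (@negligible_integral _ _ _ mu _ (~` `[0, m[%classic))//.
  - rewrite setTD setCK; apply: eq_measure_integral => A mA AI.
    by rewrite /mu /= /mrestr; congr (lebesgue_measure _); apply/setIidPl.
  - exact: measurableC.
  - by rewrite /mu /= /mrestr setICl measure0.
have int_co k : continuous k -> (@lebesgue_measure R).-integrable `[0, m[
    (EFin \o (fun t => k (T t))).
  move=> ck; have bk := continuous_bounded_on cX ck.
  have mk : measurable_fun `[0, m[%classic (k \o T).
    apply/measurable_funTS/measurableT_comp => //.
    exact: continuous_borel_measurable.
  have := integrable_param PL cX Xx0 bk mk 0 (lexx 0) (lexx m).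
  by congr (_.-integrable _ _); apply/funext => t /=; rewrite addr0.
have le_int k : continuous k -> Lam k <=
    \int[@lebesgue_measure R]_(t in `[0%R, m[) k (T t).
  move=> ck; have bk := continuous_bounded_on cX ck.
  have mk : measurable_fun `[0, m[%classic (k \o T).
    apply/measurable_funTS/measurableT_comp => //.
    exact: continuous_borel_measurable.
  apply/ler_addgt0Pr => e e0.
  (* The error of [pf_le_integral] is 2 * e' times the total mass m; adding 1
     covers the case m = 0. *)
  pose e' := e / (2 * (m + 1)).
  have m10 : 0 < 2 * (m + 1) by rewrite mulr_gt0// ltr_pwDr.
  have e'0 : 0 < e' by rewrite divr_gt0.
  have [d d0 kd] := compact_unif_continuous cX ck e'0.
  have [N sepN] := sepB d d0.
  have := pf_le_integral PL cX Xx0 bk mk sepN kd (@node_root R E Lam B) (add0n N).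
  rewrite add0r (_ : Lam _ = Lam k); last first.
    by congr Lam; apply/funext => y; rewrite indicT mulr1.
  move=> /le_trans; apply.
  rewrite RintegralD//; last 2 first.
  - exact: int_co.
  - apply: measurable_bounded_integrable => //; first exact: itvco_lty.
    by exists `|2 * e'|; split; [exact: num_real|move=> x /ltW lx t _].
  rewrite -/m lerD// Rintegral_cst//.
  have -> : fine (lebesgue_measure (`[0, m[%classic : set R)) = m.
    by have := itvco_length 0 m0; rewrite add0r.
  have e'E : e' * (2 * (m + 1)) = e by rewrite /e' divfK// gt_eqF.
  by move: e'E; clearbody e'; lra.
have intE : \int[@lebesgue_measure R]_(t in `[0%R, m[) h (T t) = Lam h.
  apply/le_anti/andP; split; last exact: le_int.
  have := le_int (fun y => -1 * h y).
  rewrite (pfZ PL)// RintegralZl//; last exact: int_co.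
  rewrite !mulN1r lerN2; apply => y; apply: cvgMl_tmp; exact: ch.
rewrite -intE fineK//; apply: integrable_fin_num => //; exact: int_co.
Qed.

(** * Mixtures of probabilities *)

Section mixture.
Context {d} {T : measurableType d} {R : realType}.
Implicit Types (P Q : probability T R) (f : T -> R).

(** For signed functions the formula is obtained by splitting into positive and
negative parts, as the integral against a sum of measures is additive on
nonnegative functions. *)
Lemma mixture_exists P Q (s t : R) : 0 <= s -> 0 <= t -> s + t = 1 ->
  exists M : probability T R,
    (forall A, M A = s%:E * P A + t%:E * Q A)%E /\
    forall f, P.-integrable setT (EFin \o f) -> Q.-integrable setT (EFin \o f) ->
      M.-integrable setT (EFin \o f) /\
      \int[M]_x f x = s * \int[P]_x f x + t * \int[Q]_x f x.
Proof.
move=> s0 t0 st1.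
pose s' := NngNum s0; pose t' := NngNum t0.
pose m : {measure set T -> \bar R} :=
  measure_add (mscale s' P) (mscale t' Q).
have mE A : (m A = s%:E * P A + t%:E * Q A)%E by exact: measure_addE.
have mT : m setT = 1%E.
  by rewrite mE !probability_setT !mule1 -EFinD st1.
pose M : probability T R :=
  HB.pack (Measure.sort m) (Measure_isProbability.Build _ _ _ m mT).
have ge0 (g : T -> \bar R) : (forall x, 0 <= g x)%E -> measurable_fun setT g ->
    (\int[M]_x g x = s%:E * \int[P]_x g x + t%:E * \int[Q]_x g x)%E.
  move=> g0 mg; rewrite ge0_integral_measure_add//.
  by rewrite !ge0_integral_mscale.
exists M; split.
  exact: mE.
move=> f fP fQ.
have mf : measurable_fun setT (EFin \o f) := measurable_int _ fP.
have fM : M.-integrable setT (EFin \o f).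
  apply/integrableP; split => //; rewrite ge0//; last exact: measurableT_comp.
  apply: lte_add_pinfty; apply: lte_mul_pinfty => //.
    by case/integrableP: fP.
  by case/integrableP: fQ.
split => //; apply: EFin_inj; rewrite EFinD !EFinM.
rewrite !fineK ?integrable_fin_num//.
rewrite [in LHS]integralE (ge0 _ _ (measurable_funepos mf))//.
rewrite (ge0 _ _ (measurable_funeneg mf))//.
rewrite (integralE P) (integralE Q).
have := integrable_pos_fin_num measurableT fP.
have := integrable_neg_fin_num measurableT fP.
have := integrable_pos_fin_num measurableT fQ.
have := integrable_neg_fin_num measurableT fQ.
do 4 (move=> /fineK <-).
by rewrite -?EFinM -?EFinB -?EFinM -?EFinD -?EFinB -?EFinM; congr EFin; ring.
Qed.

(** The normalisation of P plus the sum of the point masses w x at the entries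
of s. Keeping the mass 1 of P makes the normalising factor positive even if all
weights vanish, so the points can be added one at a time. *)
Lemma empirical_mixture_exists P (s : seq T) (w : T -> R) :
  (forall x, 0 <= w x) ->
  exists2 Q : probability T R,
    forall A, measurable A -> P A = 1%E ->
      (forall x, x \in s -> 0 < w x -> A x) -> Q A = 1%E &
    forall f, P.-integrable setT (EFin \o f) ->
      Q.-integrable setT (EFin \o f) /\
      (1 + \sum_(x <- s) w x) * \int[Q]_x f x =
      \int[P]_x f x + \sum_(x <- s) w x * f x.
Proof.
move=> w0; elim: s => [|a s [Q QA Qf]].
  by exists P => // f fP; rewrite !big_nil addr0 mul1r addr0.
pose W := 1 + \sum_(x <- s) w x.
have W0 : 0 < W by rewrite ltr_pwDl// sumr_ge0.
have Wa0 : 0 < W + w a by rewrite ltr_pwDl.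
pose D : probability T R := \d_a.
have DE A : D A = (a \in A)%:R%:E by exact: diracE.
have [||| M [MA Mf]] := @mixture_exists Q D (W / (W + w a)) (w a / (W + w a)).
- by rewrite divr_ge0 ?ltW.
- by rewrite divr_ge0 ?w0// ltW.
- by rewrite -mulrDl divff// gt_eqF.
exists M => [A mA PA sA|f fP].
  rewrite MA QA//; last by move=> x xs; apply: sA; rewrite inE xs orbT.
  have [wa|] := ltP 0 (w a).
    rewrite DE mem_set; last by apply: sA => //; rewrite mem_head.
    by rewrite !mule1 -EFinD -mulrDl divff// gt_eqF.
  move=> wa; have -> : w a = 0 by apply/le_anti; rewrite wa w0.
  by rewrite addr0 mul0r mul0e adde0 mule1 divff// gt_eqF.
have [fQ fE] := Qf f fP.
have mf : measurable_fun setT (EFin \o f) := measurable_int _ fP.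
have fd : D.-integrable setT (EFin \o f).
  apply/integrableP; split => //.
  rewrite integral_dirac//; last exact: measurableT_comp.
  by rewrite diracT mul1e ltry.
have [fM ->] := Mf f fQ fd; split => //.
have -> : \int[D]_x f x = f a.
  by rewrite /Rintegral integral_dirac// diracT mul1e.
rewrite !big_cons [in RHS]addrCA -fE [1 + _]addrCA -/W.
move: W0 Wa0; clearbody W => W0 Wa0; field.
by rewrite gt_eqF.
Qed.
End mixture.

(** * Norms on column vectors and regularity of the loss *)

Lemma entry_le_norm (R : realType) m n (M : 'M[R]_(m, n)) i j :
  `|M i j| <= `|M|.
Proof.
rewrite [leRHS]/Num.norm /= mx_normrE.
exact: (le_bigmax _ (fun ij : 'I_m * 'I_n => `|M ij.1 ij.2|) (i, j)).
Qed.

Lemma norm_le_entry (R : realType) m n (M : 'M[R]_(m, n)) (c : R) :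
  0 <= c -> (forall i j, `|M i j| <= c) -> `|M| <= c.
Proof.
move=> c0 Mc; rewrite [leLHS]/Num.norm /= mx_normrE.
by apply/bigmax_leP; split => // -[i j].
Qed.

Lemma norm_trmx (R : realType) m n (M : 'M[R]_(m, n)) : `|M^T| = `|M|.
Proof.
apply/le_anti/andP; split; apply: norm_le_entry => // i j.
  by rewrite mxE entry_le_norm.
by have := entry_le_norm M^T j i; rewrite mxE.
Qed.

Lemma norm_mulmx (R : realType) m n p (M : 'M[R]_(m, n)) (P : 'M[R]_(n, p)) :
  `|M *m P| <= n%:R * (`|M| * `|P|).
Proof.
apply: norm_le_entry => [|i j]; first by rewrite !mulr_ge0.
rewrite mxE (le_trans (ler_norm_sum _ _ _))//.
rewrite (le_trans (@ler_sum _ _ _ _ _ (fun=> `|M| * `|P|) _))//.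
  by move=> k _; rewrite normrM ler_pM// entry_le_norm.
by rewrite sumr_const card_ord mulr_natl.
Qed.

Lemma lipschitz_continuous (R : realType) (V W : pseudoMetricNormedZmodType R)
    (f : V -> W) (C : R) :
  0 <= C -> (forall u v, `|f u - f v| <= C * `|u - v|) -> continuous f.
Proof.
move=> C0 fC u; apply/cvgrPdist_lt => e e0.
have C10 : 0 < C + 1 by rewrite ltr_pwDr.
apply/nbhs_normP; exists (e / (C + 1)); first by rewrite /= divr_gt0.
move=> v /=; rewrite ltr_pdivlMr// => uv; apply: (le_lt_trans (fC u v)).
by have := normr_ge0 (u - v); move: uv; set t := `|u - v|; nra.
Qed.

Lemma trmx_continuous (R : realType) m n :
  continuous (@trmx R m n : 'M[R]_(m, n) -> 'M[R]_(n, m)).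
Proof.
apply: (@lipschitz_continuous _ _ _ _ 1) => // u v.
by rewrite -linearB/= norm_trmx mul1r.
Qed.

Lemma compact_unit_sphere (R : realType) n :
  compact [set u : 'cV[R]_n | `|u| = 1].
Proof.
pose S := [set u : 'rV[R]_n | `|u| = 1].
have cS : compact S.
  apply: bounded_closed_compact.
    by exists 1; split => // x x1 u /= ->; exact: ltW.
  rewrite (_ : S = Num.norm @^-1` [set 1]); last by apply/seteqP; split.
  by apply: closed_comp => //; move=> u _; exact: norm_continuous.
have -> : [set u : 'cV[R]_n | `|u| = 1] = trmx @` S.
  apply/seteqP; split => [u u1|_ [u u1 <-] /=]; last by rewrite norm_trmx.
  by exists u^T; rewrite ?trmxK// /S /= norm_trmx.
apply: continuous_compact cS; apply: continuous_subspaceT.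
exact: trmx_continuous.
Qed.

Section norms.
Variables (R : realType) (n : nat) (N : 'cV[R]_n -> R).
Hypothesis normN : is_norm N.

Lemma is_normD u v : N (u + v) <= N u + N v. Proof. by case: normN. Qed.

Lemma is_normZ a u : N (a *: u) = `|a| * N u. Proof. by case: normN. Qed.

Lemma is_norm0 : N 0 = 0.
Proof. by rewrite -(scale0r 0) is_normZ normr0 mul0r. Qed.

Lemma is_normN u : N (- u) = N u.
Proof. by rewrite -scaleN1r is_normZ normrN1 mul1r. Qed.

Lemma is_norm_ge0 u : 0 <= N u.
Proof. have := is_normD u (- u); rewrite subrr is_norm0 is_normN; lra. Qed.

Lemma is_norm_le : exists2 K, 0 <= K & forall u, N u <= K * `|u|.
Proof.
exists (\sum_(i < n) N (delta_mx i 0)).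
  by apply: sumr_ge0 => i _; exact: is_norm_ge0.
move=> u; rewrite {1}[u]matrix_sum_delta mulr_suml.
apply: (@le_trans _ _ (\sum_(i < n) N (\sum_(j < 1) u i j *: delta_mx i j))).
  elim/big_ind2: _ => //; first by rewrite is_norm0.
  by move=> v a w b va wb; rewrite (le_trans (is_normD _ _))// lerD.
apply: ler_sum => i _; rewrite big_ord1 is_normZ mulrC.
by rewrite ler_wpM2l ?is_norm_ge0// entry_le_norm.
Qed.

Lemma is_norm_continuous : continuous N.
Proof.
have [K K0 NK] := is_norm_le; apply: (lipschitz_continuous K0) => u v.
have h1 : N u <= N v + K * `|u - v|.
  by have := is_normD (u - v) v; rewrite subrK; have := NK (u - v); lra.
have h2 : N v <= N u + K * `|u - v|.
  by have := is_normD (v - u) u; rewrite subrK distrC; have := NK (v - u); lra.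
by rewrite ler_norml; lra.
Qed.

(** N is continuous and does not vanish on the compact unit sphere, so it is
bounded below there. *)
Lemma le_is_norm : exists2 K, 0 <= K & forall u, `|u| <= K * N u.
Proof.
have : compact (N @` [set u : 'cV[R]_n | `|u| = 1]).
  apply: continuous_compact (@compact_unit_sphere R n).
  exact/continuous_subspaceT/is_norm_continuous.
move=> /(compact_closed (@Rhausdorff R))/closed_openC oS.
have S0 : (~` (N @` [set u : 'cV[R]_n | `|u| = 1])) 0.
  move=> [u /= u1 Nu]; case: normN => _ _ /(_ u Nu) u0.
  by move: u1; rewrite u0 normr0 => /esym/eqP; rewrite oner_eq0.
have /nbhs_ballP[] := open_nbhs_nbhs (conj oS S0).
move=> e /= e0 eS; exists e^-1; first by rewrite invr_ge0 ltW.
move=> u; have [->|u0] := eqVneq u 0; first by rewrite normr0 is_norm0 mulr0.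
have nu0 : 0 < `|u| by rewrite normr_gt0.
rewrite mulrC ler_pdivlMr// leNgt; apply/negP => Nu.
apply: (eS (N (`|u|^-1 *: u))); last first.
  by exists (`|u|^-1 *: u) => //=; rewrite normrZ normfV normr_id mulVf ?gt_eqF.
rewrite /ball/= sub0r normrN ger0_norm ?is_norm_ge0// is_normZ normfV normr_id.
by rewrite mulrC ltr_pdivrMr// mulrC.
Qed.

End norms.

Lemma normr_max_le (R : realType) (a b a' b' c : R) :
  `|a - a'| <= c -> `|b - b'| <= c ->
  `|Num.max a b - Num.max a' b'| <= c.
Proof.
rewrite !ler_norml => /andP[a1 a2] /andP[b1 b2].
by case: (leP a b) => ab; case: (leP a' b') => ab'; apply/andP; split; lra.
Qed.

Section loss_regularity.
Variables (R : realType) (Dx Dxi J : nat).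
Variables (A : 'I_J.+1 -> 'M[R]_(Dxi, Dx)) (abar : 'I_J.+1 -> 'cV[R]_Dxi).
Variables (b : 'I_J.+1 -> 'cV[R]_Dx) (bbar : 'I_J.+1 -> R).
Local Notation pc := (piece A abar b bbar).
Local Notation ls := (loss A abar b bbar).

Let cst j : R := Dxi%:R * Dx%:R * `|A j| + Dx%:R * `|b j| +
  Dxi%:R * `|abar j| + `|bbar j|.

Let cst_ge0 j : 0 <= cst j.
Proof. by rewrite !addr_ge0// !mulr_ge0. Qed.

Lemma piece_lipschitz j z z' xi :
  `|pc j z xi - pc j z' xi| <= cst j * `|z - z'| * (1 + `|xi|).
Proof.
have -> : pc j z xi - pc j z' xi =
    ((A j *m (z - z'))^T *m xi) ord0 ord0 + ((b j)^T *m (z - z')) ord0 ord0.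
  rewrite !mulmxBr linearB/= mulmxBl /piece /slope /intercept !linearD/= !mulmxDl.
  by rewrite !mxE; ring.
apply: (le_trans (ler_normD _ _)).
have h1 : `|((A j *m (z - z'))^T *m xi) ord0 ord0| <=
    Dxi%:R * Dx%:R * `|A j| * `|z - z'| * `|xi|.
  apply: (le_trans (entry_le_norm _ _ _)); apply: (le_trans (norm_mulmx _ _)).
  rewrite norm_trmx -!mulrA ler_wpM2l// !mulrA ler_wpM2r//.
  by have := norm_mulmx (A j) (z - z'); rewrite mulrA.
have h2 : `|((b j)^T *m (z - z')) ord0 ord0| <= Dx%:R * `|b j| * `|z - z'|.
  apply: (le_trans (entry_le_norm _ _ _)); apply: (le_trans (norm_mulmx _ _)).
  by rewrite norm_trmx mulrA.
apply: (le_trans (lerD h1 h2)); rewrite /cst.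
have p1 : 0 <= Dxi%:R * Dx%:R * `|A j| by rewrite !mulr_ge0.
have p2 : 0 <= Dx%:R * `|b j| by rewrite !mulr_ge0.
have p3 : 0 <= Dxi%:R * `|abar j| + `|bbar j| by rewrite addr_ge0// mulr_ge0.
move: p1 p2 p3 (normr_ge0 (z - z')) (normr_ge0 xi).
set u := Dxi%:R * Dx%:R * `|A j|; set v := Dx%:R * `|b j|.
rewrite -addrA; set w := Dxi%:R * `|abar j| + `|bbar j|.
set s := `|z - z'|; set t := `|xi| => u0 v0 w0 s0 t0.
have := mulr_ge0 u0 s0; have := mulr_ge0 (mulr_ge0 v0 s0) t0.
have := mulr_ge0 w0 s0; have := mulr_ge0 (mulr_ge0 w0 s0) t0.
by lra.
Qed.

Lemma piece0_growth j xi : `|pc j 0 xi| <= cst j * (1 + `|xi|).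
Proof.
rewrite /piece /slope /intercept !mulmx0 !add0r [X in _ + (X + _)]mxE add0r.
apply: (le_trans (ler_normD _ _)).
have h1 : `|((abar j)^T *m xi) ord0 ord0| <= Dxi%:R * `|abar j| * `|xi|.
  apply: (le_trans (entry_le_norm _ _ _)); apply: (le_trans (norm_mulmx _ _)).
  by rewrite norm_trmx mulrA.
apply: (le_trans (lerD h1 (lexx _))); rewrite /cst.
have p1 : 0 <= Dxi%:R * Dx%:R * `|A j| + Dx%:R * `|b j|.
  by rewrite addr_ge0// !mulr_ge0.
have p2 : 0 <= Dxi%:R * `|abar j| by rewrite mulr_ge0.
move: p1 p2 (normr_ge0 xi) (normr_ge0 (bbar j)).
set u := _ + _ * `|b j|; set v := _ * `|abar j|; set w := `|bbar j|.
set t := `|xi| => u0 v0 t0 w0.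
have := mulr_ge0 u0 t0; have := mulr_ge0 w0 t0; lra.
Qed.

(** A maximum moves by at most the largest change of its terms, and each piece
is affine in z with coefficients that are affine in xi. *)
Lemma loss_regular : exists2 C, 0 <= C &
  (forall z z' xi, `|ls z xi - ls z' xi| <= C * `|z - z'| * (1 + `|xi|)) /\
  (forall z xi, `|ls z xi| <= C * (1 + `|z|) * (1 + `|xi|)).
Proof.
pose C := \sum_j cst j.
have C0 : 0 <= C by apply: sumr_ge0.
have cC j : cst j <= C.
  by rewrite /C (bigD1 j)//= lerDl sumr_ge0.
have lip z z' xi : `|ls z xi - ls z' xi| <= C * `|z - z'| * (1 + `|xi|).
  have h j : `|pc j z xi - pc j z' xi| <= C * `|z - z'| * (1 + `|xi|).
    apply: (le_trans (piece_lipschitz _ _ _ _)).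
    by rewrite ler_wpM2r ?addr_ge0// ler_wpM2r.
  by rewrite /loss; elim/big_ind2: _ => // a a' c c'; exact: normr_max_le.
have gr xi : `|ls 0 xi| <= C * (1 + `|xi|).
  have h j : `|pc j 0 xi| <= C * (1 + `|xi|).
    apply: (le_trans (piece0_growth _ _)).
    by rewrite ler_wpM2r ?addr_ge0.
  rewrite /loss; elim/big_ind: _ => // a c; rewrite !ler_norml.
  by case: (leP a c).
exists C => //; split => // z xi.
have -> : C * (1 + `|z|) * (1 + `|xi|) =
  C * (1 + `|xi|) + C * `|z| * (1 + `|xi|) by ring.
have -> : ls z xi = ls 0 xi + (ls z xi - ls 0 xi) by rewrite addrC subrK.
apply: (le_trans (ler_normD _ _)); apply: lerD => //.
by have := lip z 0 xi; rewrite subr0.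
Qed.

Lemma measurable_entry n (i : 'I_n) :
  measurable_fun setT (fun z : borelcV R n => (z : 'cV[R]_n) i ord0).
Proof.
apply: (@continuous_borel_measurable R 'cV[R]_n (fun z => z i ord0)).
exact: coord_continuous.
Qed.

Lemma measurable_loss : measurable_fun setT
  (fun p : borelcV R Dx * borelcV R Dxi => ls p.1 p.2).
Proof.
have mz (i : 'I_Dx) : measurable_fun setT
    (fun p : borelcV R Dx * borelcV R Dxi => (p.1 : 'cV[R]_Dx) i ord0).
  exact: measurableT_comp (measurable_entry i) measurable_fst.
have mxi (i : 'I_Dxi) : measurable_fun setT
    (fun p : borelcV R Dx * borelcV R Dxi => (p.2 : 'cV[R]_Dxi) i ord0).
  exact: measurableT_comp (measurable_entry i) measurable_snd.
have mpc j : measurable_fun setT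
    (fun p : borelcV R Dx * borelcV R Dxi => pc j p.1 p.2).
  rewrite (_ : (fun p => _) = fun p : borelcV R Dx * borelcV R Dxi =>
    \sum_(k < Dxi) (\sum_(m < Dx) A j k m * (p.1 : 'cV[R]_Dx) m ord0
       + abar j k ord0) * (p.2 : 'cV[R]_Dxi) k ord0
    + (\sum_(m < Dx) b j m ord0 * (p.1 : 'cV[R]_Dx) m ord0 + bbar j)).
    apply: measurable_funD; last first.
      apply: measurable_funD; last exact: measurable_cst.
      by apply: measurable_sum => m; exact: measurable_funM.
    apply: measurable_sum => k; apply: measurable_funM => //.
    apply: measurable_funD; last exact: measurable_cst.
    by apply: measurable_sum => m; exact: measurable_funM.
  apply/funext => p; rewrite /piece /intercept /slope !mxE; congr (_ + (_ + _)).
    by apply: eq_bigr => k _; rewrite !mxE.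
  by apply: eq_bigr => k _; rewrite !mxE.
rewrite /loss; elim: (index_enum _) => [|j s IH].
  by under eq_fun do rewrite big_nil; exact: mpc.
by under eq_fun do rewrite big_cons; apply: measurable_maxr.
Qed.

End loss_regularity.

(** * Duality *)

Lemma continuous_addc (R : realType) (T : topologicalType) (f : T -> R)
    (c : R) :
  continuous f -> continuous (fun x => f x + c).
Proof. by move=> cf x; apply: cvgD; [exact: cf|exact: cvg_cst]. Qed.

Lemma continuous_diff_cst (R : realType) (T : topologicalType)
    (f g : T -> R) (c : R) :
  continuous f -> continuous g -> continuous (fun x => f x - g x - c).
Proof.
move=> cf cg; apply: continuous_addc => x.
by apply: cvgB; [exact: cf|exact: cg].
Qed.

Lemma probC0 (R : realType) d (T : measurableType d) (P : probability T R)
    (B : set T) :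
  measurable B -> P B = 1%E -> P (~` B) = 0%E.
Proof. by move=> mB PB; rewrite probability_setC// PB subee. Qed.

Lemma Rintegral_full (R : realType) d (T : measurableType d)
    (P : probability T R) (B : set T) (f : T -> R) : measurable B -> P B = 1%E ->
  P.-integrable setT (EFin \o f) -> \int[P]_(x in B) f x = \int[P]_x f x.
Proof.
move=> mB PB fi; rewrite /Rintegral; congr fine; apply/esym.
rewrite (negligible_integral (measurableC mB))//.
  by rewrite setTD setCK.
exact: probC0.
Qed.

(** If k z0 > 0, then k exceeds k z0 / 2 on an open neighbourhood of z0, which
has positive mass by full support. *)
Lemma integral_pos_part_le0 (R : realType) n (X : set 'cV[R]_n)
    (Z : probability (borelcV R n) R) (k : 'cV[R]_n -> R) :
  compact X -> full_support_on X Z -> continuous k ->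
  ((\int[Z]_z maxe (k z)%:E 0 <= 0)%E <-> forall z, X z -> k z <= 0).
Proof.
move=> cX [ZX ZU] ck.
have mX : measurable (X : set (borelcV R n)) by exact: compact_borel_measurable.
have mk : measurable_fun setT (k : borelcV R n -> R).
  exact: continuous_borel_measurable.
have mh : measurable_fun setT (fun z : borelcV R n => maxe (k z)%:E 0%E).
  apply: measurable_maxe; last exact: measurable_cst.
  exact/measurable_EFinP.
have h0 (z : borelcV R n) : (0 <= maxe (k z)%:E 0)%E by rewrite le_max lexx orbT.
split=> [le0 z0 Xz0|kX]; last first.
  rewrite (ge0_negligible_integral (measurableC mX))//; last exact: probC0.
  rewrite setTD setCK integral0_eq// => z Xz.
  by apply/max_idPr; rewrite lee_fin kX.
rewrite leNgt; apply/negP => k0.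
pose c := k z0 / 2; have c0 : 0 < c by rewrite divr_gt0.
pose U := [set z : 'cV[R]_n | c < k z].
have oU : open U.
  rewrite (_ : U = k @^-1` `]c, +oo[%classic).
    by move/continuousP: ck; apply; exact: interval_open.
  by apply/seteqP; split => z /=; rewrite /U /= in_itv/= andbT.
have Uz0 : U z0 by rewrite /U /= /c; lra.
have mU : measurable (U : set (borelcV R n)) by exact: sub_sigma_algebra.
have := ZU z0 Xz0 U oU Uz0; rewrite ltNge => /negP; apply.
have : (c%:E * Z U <= 0)%E.
  apply: le_trans le0; rewrite -(integral_cst Z mU).
  apply: (@le_trans _ _ (\int[Z]_(z in U) maxe (k z)%:E 0)%E).
    apply: ge0_le_integral => //.
    - by move=> z _; rewrite lee_fin ltW.
    - exact: measurable_funTS.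
    - by move=> z Uz; rewrite le_max lee_fin ltW.
  exact: ge0_subset_integral.
by rewrite pmule_rle0// lte_fin.
Qed.

(** Only these properties of the loss matter for duality: joint measurability,
and Lipschitz and growth bounds in z whose constants are at most quadratic in
xi, hence integrable under a second moment bound. *)
Section duality.
Context {R : realType} {Dx Dxi : nat}.
Variables (X : set 'cV[R]_Dx) (Xi : set 'cV[R]_Dxi) (N : 'cV[R]_Dxi -> R).
Variables (l : 'cV[R]_Dx -> 'cV[R]_Dxi -> R) (C : R).
Hypothesis normN : is_norm N.
Hypothesis ml : measurable_fun setT
  (fun p : borelcV R Dx * borelcV R Dxi => l p.1 p.2).
Hypothesis C0 : 0 <= C.
Hypothesis lip : forall z z' xi,
  `|l z xi - l z' xi| <= C * `|z - z'| * (1 + N xi ^+ 2).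
Hypothesis gro : forall z xi, `|l z xi| <= C * (1 + `|z|) * (1 + N xi ^+ 2).
Local Notation T1 := (borelcV R Dx).
Local Notation T2 := (borelcV R Dxi).
Implicit Types (Q : probability T2 R).

Definition mean Q (z : 'cV[R]_Dx) : R := \int[Q]_xi l z xi.

Definition moment Q : R := \int[Q]_xi (N xi ^+ 2).

Lemma measurable_sqnorm : measurable_fun setT (fun xi : T2 => N xi ^+ 2).
Proof.
apply: measurable_funX; apply: (@continuous_borel_measurable R 'cV[R]_Dxi N).
exact: is_norm_continuous.
Qed.

Lemma measurable_l_xi z : measurable_fun setT (l z : T2 -> R).
Proof. exact: (measurable_fun_pair2 (z : T1) ml). Qed.

Lemma continuous_l_z xi : continuous (l ^~ xi).
Proof.
have q0 : 0 <= C * (1 + N xi ^+ 2) by rewrite mulr_ge0// addr_ge0// sqr_ge0.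
by apply: (lipschitz_continuous q0) => z z'; rewrite mulrAC lip.
Qed.

Lemma integrable_sqnorm Q : (second_moment N Q < +oo)%E ->
  Q.-integrable setT (EFin \o (fun xi => N xi ^+ 2)).
Proof.
rewrite /second_moment unlock => Qoo; apply/integrableP; split.
  by apply/measurable_EFinP; apply: measurable_sqnorm.
under eq_integral do rewrite /= ger0_norm ?sqr_ge0//.
exact: Qoo.
Qed.

Lemma second_momentE Q : (second_moment N Q < +oo)%E ->
  second_moment N Q = (moment Q)%:E.
Proof.
move=> Qoo; have := integrable_fin_num measurableT (integrable_sqnorm Qoo).
by rewrite /second_moment unlock /moment /Rintegral => /fineK ->.
Qed.

Lemma integrable_weight Q k : (second_moment N Q < +oo)%E ->
  Q.-integrable setT (EFin \o (fun xi => k * (1 + N xi ^+ 2))).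
Proof.
move=> Qoo; apply: (@integrableZl _ _ _ Q _ measurableT k
  (EFin \o (fun xi => 1 + N xi ^+ 2))).
rewrite (_ : EFin \o _ = (EFin \o cst 1) \+ (EFin \o (fun xi => N xi ^+ 2)))//.
apply: integrableD => //.
  exact: finite_measure_integrable_cst.
exact: integrable_sqnorm.
Qed.

Lemma integrable_l Q z : (second_moment N Q < +oo)%E ->
  Q.-integrable setT (EFin \o l z).
Proof.
move=> Qoo; apply: le_integrable (integrable_weight (C * (1 + `|z|)) Qoo) => //.
  apply/measurable_EFinP; apply: measurable_l_xi.
by move=> xi _ /=; rewrite lee_fin (le_trans (gro z xi))// ler_norm.
Qed.

Lemma expectation_mean Q z : (second_moment N Q < +oo)%E ->
  'E_Q[l z]%E = (mean Q z)%:E.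
Proof.
move=> Qoo; have := integrable_fin_num measurableT (integrable_l z Qoo).
by rewrite unlock /mean /Rintegral => /fineK ->.
Qed.

Lemma Rintegral_weight Q k : (second_moment N Q < +oo)%E ->
  \int[Q]_xi (k * (1 + N xi ^+ 2)) = k * (1 + moment Q).
Proof.
move=> Qoo; rewrite RintegralZl//; last first.
  by have := integrable_weight 1 Qoo; under eq_fun do rewrite mul1r.
rewrite RintegralD//.
- have QT : fine (Q setT) = 1 by rewrite probability_setT.
  by rewrite Rintegral_cst// mul1r; congr (_ * (_ + _)); exact: QT.
- exact: finite_measure_integrable_cst.
- exact: integrable_sqnorm.
Qed.

Lemma moment_ge0 Q : 0 <= moment Q.
Proof. by apply: Rintegral_ge0 => xi _; exact: sqr_ge0. Qed.

Lemma mean_lipschitz Q z z' : (second_moment N Q < +oo)%E ->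
  `|mean Q z - mean Q z'| <= C * (1 + moment Q) * `|z - z'|.
Proof.
move=> Qoo; rewrite /mean -RintegralB//; try exact: integrable_l.
have iB : Q.-integrable setT (EFin \o (fun xi => l z xi - l z' xi)).
  rewrite (_ : EFin \o _ = ((EFin \o l z) \- (EFin \o l z'))%E)//.
  by apply: integrableB => //; exact: integrable_l.
apply: (le_trans (le_normr_Rintegral measurableT iB)).
rewrite mulrAC -Rintegral_weight//; apply: le_Rintegral => //.
- exact: (integrable_norm iB).
- exact: integrable_weight.
Qed.

Lemma mean_continuous Q : (second_moment N Q < +oo)%E -> continuous (mean Q).
Proof.
move=> Qoo; have m0 : 0 <= C * (1 + moment Q).
  by rewrite mulr_ge0// addr_ge0// moment_ge0.
by apply: (lipschitz_continuous m0) => z z'; exact: mean_lipschitz.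
Qed.


Hypothesis cX : compact X.

Let mX : measurable (X : set T1). Proof. exact: compact_borel_measurable. Qed.

Section potential.
Variable nu : {finite_measure set T1 -> \bar R}.

Definition potential (xi : 'cV[R]_Dxi) : R := \int[nu]_(z in X) l z xi.

Lemma integrable_continuous (k : 'cV[R]_Dx -> R) : continuous k ->
  nu.-integrable X (EFin \o (k : T1 -> R)).
Proof.
move=> ck; have [M kM] := continuous_bounded_on cX ck.
apply: measurable_bounded_integrable => //.
- by rewrite -ge0_fin_numE// fin_num_measure.
- by apply: measurable_funTS; exact: continuous_borel_measurable.
- exists M; split; first exact: num_real.
  by move=> x /ltW Mx z Xz; apply: le_trans Mx; exact: kM.
Qed.

Lemma potentialE xi : (\int[nu]_(z in X) (l z xi)%:E = (potential xi)%:E)%E.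
Proof.
have := integrable_fin_num mX (integrable_continuous (continuous_l_z (xi:=xi))).
by rewrite /potential /Rintegral => /fineK ->.
Qed.

(** Since X is bounded, l is dominated on X by a multiple of 1 + N^2, which is
integrable for the product measure. *)
Lemma fubini_mean Q : (second_moment N Q < +oo)%E ->
  Q.-integrable setT (EFin \o potential) /\
  \int[Q]_xi potential xi = \int[nu]_(z in X) mean Q z.
Proof.
move=> Qoo.
have [M XM] : exists M, forall z, X z -> `|z| <= M.
  have [M [_ hM]] := compact_bounded cX.
  by exists (M + 1); apply: hM; rewrite ltrDl.
pose K := C * (1 + `|M|).
have K0 : 0 <= K by rewrite mulr_ge0// addr_ge0.
pose f (p : T1 * T2) : \bar R := (l p.1 p.2 * \1_X p.1)%:E.
pose g (p : T1 * T2) : \bar R := (K * (1 + N p.2 ^+ 2))%:E.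
have mf : measurable_fun setT f.
  apply/measurable_EFinP; apply: measurable_funM => //.
  exact: measurableT_comp (measurable_indic mX) measurable_fst.
have mg : measurable_fun setT g.
  apply/measurable_EFinP; apply: measurable_funM; first exact: measurable_cst.
  apply: measurable_funD; first exact: measurable_cst.
  exact: measurableT_comp measurable_sqnorm measurable_snd.
have q0 xi : 0 <= K * (1 + N xi ^+ 2) by rewrite mulr_ge0// addr_ge0// sqr_ge0.
have ig : (nu \x Q)%E.-integrable setT g.
  apply/(integrable12ltyP _ _ mg).
  rewrite (eq_integral (fun=> (K * (1 + moment Q))%:E)).
    by rewrite integral_cst// lte_mul_pinfty ?ltry// ?lee_fin ?mulr_ge0//
      ?addr_ge0 ?moment_ge0// -ge0_fin_numE// fin_num_measure.
  move=> z _; rewrite -Rintegral_weight//.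
  have iw := integrable_fin_num measurableT (integrable_weight K Qoo).
  rewrite /Rintegral fineK//; apply: eq_integral => xi _.
  by rewrite /g /= ger0_norm.
have imf : (nu \x Q)%E.-integrable setT f.
  apply: le_integrable ig => //.
  move=> [z xi] _ /=; rewrite lee_fin normrM indicE.
  have [Xz|_] := boolP (z \in X); last by rewrite normr0 mulr0.
  rewrite normr1 mulr1 (ger0_norm (q0 xi)); apply: (le_trans (gro z xi)).
  rewrite ler_wpM2r ?addr_ge0 ?sqr_ge0// ler_wpM2l// lerD2l.
  by rewrite inE in Xz; apply: (le_trans (XM z Xz)); exact: ler_norm.
have innerE (xi : T2) : (\int[nu]_z f (z, xi) = (potential xi)%:E)%E.
  rewrite -potentialE [RHS]integral_mkcond; apply: eq_integral => z _.
  rewrite /f /= /patch indicE.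
  by case: ifP => _; rewrite ?mulr1 ?mulr0.
have innerQ (z : T1) : (\int[Q]_xi f (z, xi) = (mean Q z * \1_X z)%:E)%E.
  rewrite /f /= indicE; case: (z \in X); last first.
    by under eq_integral do rewrite mulr0; rewrite integral0 mulr0.
  by under eq_integral do rewrite mulr1; rewrite mulr1 -expectation_mean// unlock.
have Fub := Fubini imf.
have mpot : measurable_fun setT (EFin \o potential : T2 -> \bar R).
  have := measurable_fubini_G imf; congr measurable_fun.
  by apply/funext => xi; exact: innerE.
have nuX : (nu X < +oo)%E by rewrite -ge0_fin_numE// fin_num_measure.
have ipot : Q.-integrable setT (EFin \o potential).
  apply: le_integrable (integrable_weight (K * fine (nu X)) Qoo) => //.
  move=> xi _ /=; rewrite lee_fin.
  have il := integrable_continuous (continuous_l_z (xi:=xi)).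
  apply: (le_trans (le_normr_Rintegral mX il)).
  rewrite [leRHS]ger0_norm; last by rewrite mulrAC mulr_ge0 ?fine_ge0.
  rewrite mulrAC -(Rintegral_cst nu mX); apply: le_Rintegral => //.
  - exact: integrable_norm il.
  - exact: finite_measure_integrable_cst.
  move=> z Xz; apply: (le_trans (gro z xi)).
  rewrite ler_wpM2r ?addr_ge0 ?sqr_ge0// ler_wpM2l// lerD2l.
  by apply: (le_trans (XM z Xz)); exact: ler_norm.
split=> //; rewrite /Rintegral; congr fine.
transitivity (\int[Q]_xi \int[nu]_z f (z, xi))%E.
  by apply: eq_integral => xi _; rewrite innerE.
rewrite -Fub [RHS]integral_mkcond; apply: eq_integral => z _.
by rewrite innerQ /patch indicE; case: ifP => _; rewrite ?mulr1 ?mulr0.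
Qed.

End potential.

Variables (Phat : probability T2 R) (Z : probability T1 R) (Omega eps : R).
Hypothesis mXi : measurable (Xi : set T2).
Hypothesis PXi : prob_on Xi Phat.
Hypothesis P2 : (second_moment N Phat < Omega%:E)%E.
Hypothesis fsZ : full_support_on X Z.
Hypothesis eps0 : 0 < eps.

Local Notation amb := (ambiguity_set Xi N l Phat Omega eps Z).
Local Notation worst := (worst_case Xi N l Phat Omega eps Z).
Local Notation feasible := (lp_feasible X Xi N l).
Local Notation objective := (lp_objective X l Phat Omega eps).

Let Poo : (second_moment N Phat < +oo)%E.
Proof. exact: lt_trans P2 (ltry _). Qed.

Lemma ambiguity_setP Q : amb Q <->
  [/\ prob_on Xi Q, (second_moment N Q <= Omega%:E)%E &
      forall z, X z -> mean Q z <= mean Phat z + eps].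
Proof.
have key : (second_moment N Q <= Omega%:E)%E ->
    (\int[Z]_z maxe ('E_Q[l z] - 'E_Phat[l z] - eps%:E) 0 <= 0)%E <->
    forall z, X z -> mean Q z <= mean Phat z + eps.
  move=> Q2.
  have Qoo : (second_moment N Q < +oo)%E by exact: le_lt_trans Q2 (ltry _).
  pose k z := mean Q z - mean Phat z - eps.
  have ck : continuous k.
    apply: continuous_diff_cst; last exact: mean_continuous.
    exact: mean_continuous.
  have -> : (\int[Z]_z maxe ('E_Q[l z] - 'E_Phat[l z] - eps%:E) 0 =
      \int[Z]_z maxe (k z)%:E 0)%E.
    by apply: eq_integral => z _; rewrite !expectation_mean.
  rewrite (integral_pos_part_le0 cX fsZ ck).
  by split=> h z Xz; have := h z Xz; rewrite /k; lra.
by split=> -[h1 h2 h3]; split => //; apply/key.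
Qed.

Lemma ambiguity_set_Phat : amb Phat.
Proof.
apply/ambiguity_setP; split => //; first exact: ltW.
by move=> z _; rewrite lerDl ltW.
Qed.

Lemma ambiguity_lty Q : amb Q -> (second_moment N Q < +oo)%E.
Proof. by case/ambiguity_setP => _ /le_lt_trans Q2 _; apply: Q2; rewrite ltry. Qed.

Lemma ambiguity_moment Q : amb Q -> moment Q <= Omega.
Proof.
move=> aQ; have Qoo := ambiguity_lty aQ.
by case/ambiguity_setP: aQ => _ + _; rewrite second_momentE.
Qed.

Lemma lp_objectiveE p : objective p = (lp_alpha p + lp_beta p * Omega +
  \int[lp_nu p]_(z in X) (mean Phat z + eps))%:E.
Proof.
have cm : continuous (fun z => mean Phat z + eps).
  by apply: continuous_addc; exact: mean_continuous.
rewrite /lp_objective [RHS]EFinD; congr (_ + _)%E.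
have ic := integrable_continuous (lp_nu p) cm.
have := integrable_fin_num mX ic; rewrite /Rintegral => /fineK ->.
by apply: eq_integral => z _; rewrite expectation_mean.
Qed.

Lemma weak_duality p Q : feasible p -> amb Q ->
  ('E_Q[l (lp_x p)] <= objective p)%E.
Proof.
move=> [Xx b0 nuX ineq] aQ; have Qoo := ambiguity_lty aQ.
have Qm := ambiguity_moment aQ.
case/ambiguity_setP: aQ => QXi _ Qz.
rewrite expectation_mean// lp_objectiveE lee_fin.
set x := lp_x p in Xx ineq *; set al := lp_alpha p in ineq *.
set be := lp_beta p in b0 ineq *; set nu := lp_nu p in nuX ineq *.
have [ipot potE] := fubini_mean nu Qoo.
have iN := integrable_sqnorm Qoo.
have ibN : Q.-integrable setT (EFin \o (fun xi => be * N xi ^+ 2)).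
  exact: (@integrableZl _ _ _ Q _ measurableT be (EFin \o (fun xi => N xi ^+ 2))).
have iabN : Q.-integrable setT (EFin \o (fun xi => al + be * N xi ^+ 2)).
  rewrite (_ : EFin \o _ =
    (EFin \o cst al) \+ (EFin \o (fun xi => be * N xi ^+ 2)))//.
  by apply: integrableD => //; exact: finite_measure_integrable_cst.
have iall : Q.-integrable setT
    (EFin \o (fun xi => al + be * N xi ^+ 2 + potential nu xi)).
  rewrite (_ : EFin \o _ =
    (EFin \o (fun xi => al + be * N xi ^+ 2)) \+ (EFin \o potential nu))//.
  exact: integrableD.
have QT : fine (Q setT) = 1 by rewrite probability_setT.
apply: (@le_trans _ _ (\int[Q]_xi (al + be * N xi ^+ 2 + potential nu xi))).
  rewrite /mean -(Rintegral_full mXi QXi (integrable_l x Qoo)).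
  rewrite -(Rintegral_full mXi QXi iall).
  apply: le_Rintegral => //.
  - exact: integrableS (integrable_l x Qoo).
  - exact: integrableS iall.
  move=> xi Xxi; have := ineq xi Xxi.
  by rewrite potentialE -EFinD lee_fin.
rewrite RintegralD// RintegralD//; last exact: finite_measure_integrable_cst.
rewrite RintegralZl// Rintegral_cst// [fine _]QT mulr1 potE.
have cQ := mean_continuous Qoo; have cP := mean_continuous Poo.
apply: lerD; first by rewrite lerD2l ler_wpM2l.
apply: le_Rintegral => //.
- exact: integrable_continuous.
- by apply: integrable_continuous; exact: continuous_addc.
Qed.

(** The growth bound and E_Q[N^2] <= Omega make the supremum finite for every x,
inside X or not, so that it is a real function on the whole space. *)
Lemma worst_caseP x : exists V, [/\ worst x = V%:E,
  forall Q, amb Q -> mean Q x <= V &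
  forall W, (forall Q, amb Q -> mean Q x <= W) -> V <= W].
Proof.
pose S := [set mean Q x | Q in amb].
have S0 : S !=set0 by exists (mean Phat x), Phat => //; exact: ambiguity_set_Phat.
pose K := C * (1 + `|x|) * (1 + Omega).
have SK Q : amb Q -> mean Q x <= K.
  move=> aQ; have Qoo := ambiguity_lty aQ.
  apply: (@le_trans _ _ (C * (1 + `|x|) * (1 + moment Q))); last first.
    by rewrite ler_wpM2l ?mulr_ge0 ?addr_ge0// lerD2l ambiguity_moment.
  rewrite -Rintegral_weight//; apply: le_Rintegral => //.
  - exact: integrable_l.
  - exact: integrable_weight.
  by move=> xi _; rewrite (le_trans _ (gro x xi))// ler_norm.
have hS : has_sup S by split => //; exists K => _ [Q aQ <-]; exact: SK.
exists (sup S); split.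
- rewrite /worst_case -ereal_sup_EFin//; last by case: hS.
  congr ereal_sup; apply/seteqP; split => y [].
    move=> Q aQ <-; exists (mean Q x); first by exists Q.
    by rewrite expectation_mean//; exact: ambiguity_lty.
  move=> _ [Q aQ <-] <-; exists Q => //.
  by rewrite expectation_mean//; exact: ambiguity_lty.
- by move=> Q aQ; apply: ub_le_sup; [case: hS|exists Q].
- by move=> W WQ; apply: ge_sup => // _ [Q aQ <-]; exact: WQ.
Qed.

(** The functions [mean Q] are Lipschitz with a common constant, since second
moments are bounded by Omega; so is their supremum. *)
Lemma worst_case_attained : exists2 x, X x &
  forall x', X x' -> (worst x <= worst x')%E.
Proof.
have /choice[V VP] := worst_caseP.
have X0 : X !=set0.
  apply/set0P/negP => /eqP X0; case: fsZ => + _.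
  by rewrite /prob_on /= X0 measure0 => /eqP; rewrite eqe eq_sym oner_eq0.
pose K := C * (1 + Omega).
have O0 : 0 <= Omega.
  exact: le_trans (moment_ge0 _) (ambiguity_moment ambiguity_set_Phat).
have K0 : 0 <= K by rewrite mulr_ge0// addr_ge0.
have VK x x' : V x <= V x' + K * `|x - x'|.
  have [_ _ Vle] := VP x; have [_ Vge _] := VP x'.
  apply: Vle => Q aQ; have := Vge Q aQ.
  have := mean_lipschitz x x' (ambiguity_lty aQ).
  have : C * (1 + moment Q) * `|x - x'| <= K * `|x - x'|.
    by rewrite ler_wpM2r// ler_wpM2l// lerD2l ambiguity_moment.
  by rewrite ler_norml => h1 /andP[_ h2] h3; lra.
have cV : continuous V.
  apply: (lipschitz_continuous K0) => x x'; rewrite ler_norml.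
  by have := VK x x'; have := VK x' x; rewrite (distrC x' x); lra.
have [x /[!inE] Xx Vx] := compact_EVT_min X0 cX (continuous_subspaceT cV).
exists x => // x' Xx'; have [-> _ _] := VP x; have [-> _ _] := VP x'.
by rewrite lee_fin; apply: Vx; rewrite inE.
Qed.

Section penalty.
Variables (x : 'cV[R]_Dx) (V : R).
Hypothesis Xx : X x.
Hypothesis V_ge : forall Q, amb Q -> mean Q x <= V.
Hypothesis V_le : V <= mean Phat x + eps.

Definition slack : R := Num.min (Omega - moment Phat) eps.

(** With the weight eps / slack, the estimate at the end of
[penalized_separation] would only give V >= E_Phat[l x] + eps, which is not
contradictory; the factor 2 makes it strict. *)
Definition penalty : R := 2 * eps / slack.

Let Y := ('cV[R]_Dx + bool)%type.

(** The index inl z stands for the constraint at z, inr true for the second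
moment constraint, and inr false for no constraint. *)
Definition penalty_index : set Y :=
  [set y | if y is inl z then X z else True].

Definition penalized (xi : 'cV[R]_Dxi) (y : Y) : R :=
  if `[< Xi xi >] then
    l x xi - V -
      match y with
      | inl z => penalty * (l z xi - (mean Phat z + eps))
      | inr b => if b then penalty * (N xi ^+ 2 - Omega) else 0
      end
  else 0.

Lemma slack_gt0 : 0 < slack.
Proof.
by rewrite lt_min eps0 andbT subr_gt0 -lte_fin -second_momentE.
Qed.

Lemma penalty_gt0 : 0 < penalty.
Proof. by rewrite divr_gt0 ?slack_gt0// mulr_gt0. Qed.

(** Suppose that the weighted sums are positive for all indices, and let Q be
Phat plus t times the weighted point masses, normalised. If d > 0 denotes the
excess of the weighted sum of l x over V, then every constraint is violated by
the point masses by less than d / penalty. For t = 2 eps / d this violation is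
compensated by the slack of Phat, so that Q is in the ambiguity set. But then
V - E_Phat[l x] >= t d = 2 eps, while V <= E_Phat[l x] + eps. *)
Lemma penalized_separation (s : seq 'cV[R]_Dxi) (w : 'cV[R]_Dxi -> R) :
  (forall xi, 0 <= w xi) ->
  exists2 y, penalty_index y & \sum_(xi <- s) w xi * penalized xi y <= 0.
Proof.
move=> w0; apply: contrapT => /forall2NP nex.
have {nex}pos y : penalty_index y -> 0 < \sum_(xi <- s) w xi * penalized xi y.
  by move=> Dy; case: (nex y) => // /negP; rewrite -ltNge.
(* Points outside Xi contribute nothing to the sums. *)
pose u xi := if `[< Xi xi >] then w xi else 0.
have u0 xi : 0 <= u xi by rewrite /u; case: ifP.
pose W := \sum_(xi <- s) u xi.
pose S (f : 'cV[R]_Dxi -> R) := \sum_(xi <- s) u xi * f xi.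
have W0 : 0 <= W by exact: sumr_ge0.
have sumE y g : (forall xi, Xi xi -> penalized xi y = l x xi - V - g xi) ->
    \sum_(xi <- s) w xi * penalized xi y = S (l x) - W * V - S g.
  move=> yg; rewrite /S /W mulr_suml -!sumrB; apply: eq_bigr => xi _.
  rewrite /u; have [Xxi|nXxi] := asboolP (Xi xi).
    by rewrite yg//; ring.
  by rewrite /penalized asboolF// mulr0; ring.
have penM := penalty_gt0; have sl0 := slack_gt0.
pose d := S (l x) - W * V.
have d0 : 0 < d.
  have := pos (inr false) I; rewrite (sumE _ (fun=> 0)).
    by rewrite {2}/S big1 ?subr0// => xi _; rewrite mulr0.
  by move=> xi Xxi; rewrite /penalized asboolT.
have dN : penalty * (S (fun xi => N xi ^+ 2) - W * Omega) < d.
  have := pos (inr true) I.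
  rewrite (sumE _ (fun xi => penalty * (N xi ^+ 2 - Omega))).
    rewrite subr_gt0; congr (_ < _); rewrite /S /W mulr_suml -sumrB mulr_sumr.
    by apply: eq_bigr => xi _; ring.
  by move=> xi Xxi; rewrite /penalized asboolT.
have dl z : X z -> penalty * (S (l z) - W * (mean Phat z + eps)) < d.
  move=> Xz; have := pos (inl z) Xz.
  rewrite (sumE _ (fun xi => penalty * (l z xi - (mean Phat z + eps)))).
    rewrite subr_gt0; congr (_ < _); rewrite /S /W mulr_suml -sumrB mulr_sumr.
    by apply: eq_bigr => xi _; ring.
  by move=> xi Xxi; rewrite /penalized asboolT.
pose t := 2 * eps / d.
have t0 : 0 < t by rewrite divr_gt0// mulr_gt0.
have tE v : penalty * v < d -> t * v < slack.
  rewrite /penalty /t => h.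
  rewrite mulrAC ltr_pdivrMr//; move: h.
  by rewrite mulrAC ltr_pdivrMr// (mulrC d).
have tu0 xi : 0 <= t * u xi by rewrite mulr_ge0// ltW.
have [Q QA Qf] := empirical_mixture_exists Phat s tu0.
have QXi : prob_on Xi Q.
  apply: QA => // xi _; rewrite /u; case: asboolP => //.
  by rewrite mulr0 ltxx.
have WE : \sum_(xi <- s) t * u xi = t * W by rewrite mulr_sumr.
have SE f : \sum_(xi <- s) t * u xi * f xi = t * S f.
  by rewrite mulr_sumr; apply: eq_bigr => xi _; rewrite mulrA.
rewrite WE in Qf.
have T0 : 0 < 1 + t * W by rewrite ltr_pwDl// mulr_ge0// ltW.
have [iN] := Qf _ (integrable_sqnorm Poo).
rewrite -/(moment Q) -/(moment Phat) SE => NE.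
have Qoo : (second_moment N Q < +oo)%E.
  by rewrite /second_moment unlock; exact: integrable_lty iN.
have lE z : (1 + t * W) * mean Q z = mean Phat z + t * S (l z).
  by have [_] := Qf _ (integrable_l z Poo); rewrite SE.
have aQ : amb Q.
  apply/ambiguity_setP; split => //.
    rewrite second_momentE// lee_fin -(ler_pM2l T0) NE.
    have := tE _ dN; have : slack <= Omega - moment Phat by rewrite ge_min lexx.
    lra.
  move=> z Xz; rewrite -(ler_pM2l T0) lE.
  have := tE _ (dl z Xz); have : slack <= eps by rewrite ge_min lexx orbT.
  by lra.
have := V_ge aQ; rewrite -(ler_pM2l T0) lE.
have : t * d = 2 * eps by rewrite /t divfK// gt_eqF.
rewrite /d; move: V_le eps0; lra.
Qed.

(** The functional of [minimax_functional] splits into its parts on X, on the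
moment constraint, and on the trivial index. The first two, times the penalty,
are the multipliers nu and beta; alpha is then the value for which the objective
equals V. *)
Lemma dual_attained :
  exists p, [/\ feasible p, lp_x p = x & objective p = V%:E].
Proof.
have penM := penalty_gt0.
pose lift (h : 'cV[R]_Dx -> R) (y : Y) : R := if y is inl z then h z else 0.
pose ind (y : Y) : R := if y is inr true then 1 else 0.
have blift h : bounded_on X h -> bounded_on penalty_index (lift h).
  move=> [b hb]; exists `|b| => -[z Xz|c _] /=; last by rewrite normr0.
  by rewrite (le_trans (hb z Xz))// ler_norm.
have bind : bounded_on penalty_index ind.
  by exists 1 => -[z _|[] _] /=; rewrite ?normr0 ?normr1.
pose g z := mean Phat z + eps.
have cg : continuous g by apply: continuous_addc; exact: mean_continuous.
have bkl xi : bounded_on X (fun z => l z xi + -1 * g z).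
  have cl := continuous_l_z (xi:=xi).
  by apply: bounded_onD; [|apply: bounded_onZ]; exact: continuous_bounded_on.
have penE xi : Xi xi -> penalized xi = fun y => (l x xi - V) * 1 +
    ((- penalty) * lift (fun z => l z xi + -1 * g z) y
     + (- (penalty * (N xi ^+ 2 - Omega))) * ind y).
  move=> Xxi; apply/funext => -[z|[]]; rewrite /penalized asboolT//= /g; ring.
have bpen xi : bounded_on penalty_index (penalized xi).
  have [Xxi|nXxi] := pselect (Xi xi); last first.
    rewrite (_ : penalized xi = fun=> 0); first exact: bounded_on_cst.
    by apply/funext => y; rewrite /penalized asboolF.
  rewrite penE//; apply: bounded_onD; first exact/bounded_onZ/bounded_on_cst.
  by apply: bounded_onD; apply: bounded_onZ => //; exact: blift.
have [Lam [PL Lam1 Lam0]] := minimax_functional bpen penalized_separation.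
pose LamX h := penalty * Lam (lift h).
have PLX : positive_functional X LamX.
  split.
  - move=> h k bh bk; rewrite /LamX -mulrDr -(pfD PL); try exact: blift.
    by congr (_ * Lam _); apply/funext => -[z|c] //=; rewrite addr0.
  - move=> a h bh; rewrite /LamX mulrCA -[a * _](pfZ PL); last exact: blift.
    by congr (_ * Lam _); apply/funext => -[z|c] //=; rewrite mulr0.
  - move=> h bh h0; apply: mulr_ge0; first exact: ltW.
    apply: (pf_ge0 PL); first exact: blift.
    by move=> -[z Xz|c] //=; exact: h0.
have [nu [nuX nuE]] := riesz_representation cX Xx PLX.
have Rnu h : continuous h -> \int[nu]_(z in X) h z = LamX h.
  by move=> ch; rewrite /Rintegral nuE.
pose beta := penalty * Lam ind.
have beta0 : 0 <= beta.
  apply: mulr_ge0; first exact: ltW.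
  by apply: (pf_ge0 PL) => // -[z|[]] _ /=.
pose alpha := V - beta * Omega - LamX g.
exists (LPPoint x alpha beta nu); split => //; last first.
  by rewrite lp_objectiveE /= Rnu// /alpha /g; congr EFin; ring.
split => //= xi Xxi.
have cl := continuous_l_z (xi:=xi).
rewrite potentialE -EFinD lee_fin /potential Rnu//.
have := Lam0 xi; rewrite penE//.
rewrite (pfD PL); [|exact/bounded_onZ/bounded_on_cst|]; last first.
  by apply: bounded_onD; apply: bounded_onZ => //; exact: blift.
rewrite (pfD PL); [|by apply: bounded_onZ; exact: blift|by apply: bounded_onZ].
rewrite (pfZ PL); last exact: bounded_on_cst.
rewrite (pfZ PL); last exact: blift.
rewrite (pfZ PL)// Lam1.
have -> : - penalty * Lam (lift (fun z => l z xi + -1 * g z)) =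
    - (LamX (l ^~ xi) - LamX g).
  rewrite mulNr -/(LamX _) (pfD PLX) ?(pfZ PLX) ?mulN1r//.
  - exact: continuous_bounded_on.
  - exact: continuous_bounded_on.
  - by apply: bounded_onZ; exact: continuous_bounded_on.
have -> : - (penalty * (N xi ^+ 2 - Omega)) * Lam ind =
  - (beta * (N xi ^+ 2 - Omega)) by rewrite /beta; ring.
by rewrite /alpha; lra.
Qed.

End penalty.

Lemma strong_duality x : X x ->
  exists p, [/\ feasible p, lp_x p = x & objective p = worst x].
Proof.
move=> Xx; have [V [-> Vge Vle]] := worst_caseP x.
apply: dual_attained => //; apply: Vle => Q.
by case/ambiguity_setP => _ _; apply.
Qed.

End duality.

(** * The theorem *)

Theorem theorem2 (R : realType) (Dx Dxi J : nat)
  (X : set 'cV[R]_Dx) (Xi : set 'cV[R]_Dxi) (N : 'cV[R]_Dxi -> R)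
  (A : 'I_J.+1 -> 'M[R]_(Dxi, Dx)) (abar : 'I_J.+1 -> 'cV[R]_Dxi)
  (b : 'I_J.+1 -> 'cV[R]_Dx) (bbar : 'I_J.+1 -> R)
  (c1 c2 Omega eps : R)
  (Pstar Phat : probability (borelcV R Dxi) R)
  (Z : probability (borelcV R Dx) R) :
  let l := loss A abar b bbar in
  let worst := worst_case Xi N l Phat Omega eps Z in
  let feasible := lp_feasible X Xi N l in
  let objective := lp_objective X l Phat Omega eps in
  compact X ->
  convex_set X ->
  measurable (Xi : set (borelcV R Dxi)) ->
  is_norm N ->
  0 <= c1 -> 0 <= c2 ->
  (forall x xi, X x -> Xi xi -> `|l x xi| <= c1 + c2 * N xi) ->
  prob_on Xi Pstar ->
  prob_on Xi Phat ->
  (second_moment N Phat < Omega%:E)%E ->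
  (second_moment N Pstar <= Omega%:E)%E ->
  full_support_on X Z ->
  0 < eps ->
  [/\ optimal_value X worst = optimal_value feasible objective,
      minimizers X worst =
        [set lp_x p | p in minimizers feasible objective]
    & exists p, minimizers feasible objective p].

Proof.
move=> l worst feasible objective cX _ mXi normN _ _ _ _ PXi P2 _ fsZ eps0.
have [C0 C00 [lip0 gro0]] := loss_regular A abar b bbar.
have [K K0 NK] := le_is_norm normN.
pose C := C0 * (1 + K).
have C_ge0 : 0 <= C by rewrite mulr_ge0// addr_ge0.
have weight xi : 1 + `|xi| <= (1 + K) * (1 + N xi ^+ 2).
  have N1 : N xi <= 1 + N xi ^+ 2 by nra.
  have := ler_wpM2l K0 N1; have := NK xi; have := sqr_ge0 (N xi); lra.
have lip z z' xi : `|l z xi - l z' xi| <= C * `|z - z'| * (1 + N xi ^+ 2).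
  apply: (le_trans (lip0 z z' xi)).
  have -> : C * `|z - z'| * (1 + N xi ^+ 2) =
    C0 * `|z - z'| * ((1 + K) * (1 + N xi ^+ 2)) by rewrite /C; ring.
  by rewrite ler_wpM2l// mulr_ge0.
have gro z xi : `|l z xi| <= C * (1 + `|z|) * (1 + N xi ^+ 2).
  apply: (le_trans (gro0 z xi)).
  have -> : C * (1 + `|z|) * (1 + N xi ^+ 2) =
    C0 * (1 + `|z|) * ((1 + K) * (1 + N xi ^+ 2)) by rewrite /C; ring.
  by rewrite ler_wpM2l// mulr_ge0// addr_ge0.
have ml := measurable_loss A abar b bbar.
have strong x : X x ->
    exists p, [/\ feasible p, lp_x p = x & objective p = worst x].
  by move=> Xx; apply: (strong_duality normN ml C_ge0 lip gro).
have weak p : feasible p -> (worst (lp_x p) <= objective p)%E.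
  move=> fp; apply: ge_ereal_sup => _ [Q aQ <-].
  by apply: (weak_duality normN ml C_ge0 lip gro cX mXi P2 fsZ fp aQ).
have [x0 Xx0 minx0] : exists2 x, X x & forall x', X x' -> (worst x <= worst x')%E.
  by apply: (worst_case_attained normN ml C_ge0 lip gro).
have valX : optimal_value X worst = worst x0.
  apply/le_anti/andP; split; first by apply: ereal_inf_lbound; exists x0.
  by apply: le_ereal_inf_tmp => _ [x Xx <-]; exact: minx0.
have feasX p : feasible p -> X (lp_x p) by case.
have valE : optimal_value X worst = optimal_value feasible objective.
  apply/le_anti/andP; split.
    apply: le_ereal_inf_tmp => _ [p fp <-]; rewrite valX.
    by apply: le_trans (weak p fp); exact/minx0/feasX.
  rewrite valX; have [p [fp _ <-]] := strong x0 Xx0.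
  by apply: ereal_inf_lbound; exists p.
have lift x : minimizers X worst x ->
    exists2 p, minimizers feasible objective p & lp_x p = x.
  move=> [Xx wx]; have [p [fp px pobj]] := strong x Xx.
  by exists p => //; split=> //; rewrite pobj wx valE.
split => //; last first.
  by have [|p ? _] := lift x0; [split | exists p].
apply/seteqP; split => [x /lift[p]|_ [p [fp pobj] <-]]; first by exists p.
split; first exact: feasX.
apply/le_anti/andP; split; last first.
  by apply: ereal_inf_lbound; exists (lp_x p) => //; exact: feasX.
by rewrite valE -pobj; exact: weak.
Qed.
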